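(* Let $(L,\omega,\psi_+,\psi_-)$ be a 6-manifold with an $\mathrm{SU}(3)$-structure with torsion forms $\pi_0,\sigma_0,\pi_1,\nu_1,\pi_2,\sigma_2,\nu_3$. Let $f,\alpha,\beta$ be smooth functions on an open interval $I_f$ with $f$ nowhere vanishing and nonconstant and $\alpha^2+\beta^2=1$, and let $\varphi=f^2\,\omega\wedge dt+f^3(\alpha\psi_+-\beta\psi_-)$ be the corresponding warped $\mathrm{G}_2$-structure on $M=I_f\times L$. Then the torsion forms of $\varphi$ are $$\tau_0=\frac{4}{7f}\big(3\pi_0\alpha-3\sigma_0\beta+f\alpha\beta'-f\beta\alpha'\big),$$ $$\tau_1=\frac{1}{2f}\big(\pi_0\beta+\sigma_0\alpha+2f'\big)dt+\frac{\nu_1}{6}+\frac{\pi_1}{6},$$ $$\begin{aligned}\tau_2=&-\tfrac23\ast_6(\nu_1\wedge\omega^2)\wedge dt+\tfrac13\ast_6(\pi_1\wedge\omega^2)\wedge dt-\tfrac13f\beta\ast_6(\pi_1\wedge\psi_+)-\tfrac13f\alpha\ast_6(\pi_1\wedge\psi_-)\\&+\tfrac23f\beta\ast_6(\nu_1\wedge\psi_+)+\tfrac23f\alpha\ast_6(\nu_1\wedge\psi_-)-f\beta\,\pi_2-f\alpha\,\sigma_2,\end{aligned}$$ $$\begin{aligned}\tau_3=&-\tfrac{3}{14}f^2\big(\pi_0\alpha^2-\sigma_0\alpha\beta-2f\beta'\big)\psi_++\tfrac{3}{14}f^2\big(\pi_0\alpha\beta-\sigma_0\beta^2+2f\alpha'\big)\psi_-\\&+\tfrac27f\big(\pi_0\alpha-\sigma_0\beta-2f\alpha\beta'+2f\beta\alpha'\big)\omega\wedge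 dt-\tfrac12f^2\ast_6(\nu_1\wedge\omega)+\tfrac12f^2\ast_6(\pi_1\wedge\omega)\\&+\tfrac12f\alpha\ast_6(\pi_1\wedge\psi_+)\wedge dt-\tfrac12f\beta\ast_6(\pi_1\wedge\psi_-)\wedge dt-\tfrac12f\alpha\ast_6(\nu_1\wedge\psi_+)\wedge dt\\&+\tfrac12f\beta\ast_6(\nu_1\wedge\psi_-)\wedge dt+f(\alpha\pi_2-\beta\sigma_2)\wedge dt-f^2\ast_6\nu_3.\end{aligned}$$
   Context: An $\mathrm{SU}(3)$-structure $(\omega,\psi_+,\psi_-)$ on a 6-manifold $L$ consists of a 2-form $\omega$ and 3-forms $\psi_\pm$ for which there are local coframes $\{e^1,\dots,e^6\}$ with $\omega=e^{12}+e^{34}+e^{56}$, $\psi_+=e^{135}-e^{146}-e^{236}-e^{245}$, $\psi_-=e^{136}+e^{145}+e^{235}-e^{246}$ (so $\psi_++i\psi_-=(e^1+ie^2)\wedge(e^3+ie^4)\wedge(e^5+ie^6)$). Such coframes are orthonormal for the induced metric $g_{\omega,\psi_+}$, $J$ is the induced almost complex structure, and $\ast_6$ is the Hodge star of $g_{\omega,\psi_+}$ with volume form $\frac16\omega^3$. The torsion forms are the functions $\pi_0,\sigma_0$, the 1-forms $\pi_1,\nu_1$, the 2-forms $\pi_2,\sigma_2\in\Omega^2_8(L)=\{\beta\in\Omega^2(L):J\beta=\beta,\ \beta\wedge\omega^2=0\}$ (on which $\ast_6\beta=-\beta\wedge\omega$ and $\beta\wedge\psi_\pm=0$) and the 3-form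 $\nu_3\in\Omega^3_{12}(L)=\{\gamma:\gamma\wedge\omega=0,\ \gamma\wedge\psi_\pm=0\}$ determined by $d\omega=-\frac32\sigma_0\psi_++\frac32\pi_0\psi_-+\nu_1\wedge\omega+\nu_3$, $d\psi_+=\pi_0\omega^2+\pi_1\wedge\psi_+-\pi_2\wedge\omega$, $d\psi_-=\sigma_0\omega^2+\pi_1\wedge\psi_--\sigma_2\wedge\omega$. A $\mathrm{G}_2$-structure on a 7-manifold $M$ is a 3-form $\varphi$ for which there are local coframes with $\varphi=e^{127}+e^{347}+e^{567}+e^{135}-e^{146}-e^{236}-e^{245}$; these are declared orthonormal and oriented (volume $e^{1234567}$), defining $g_\varphi$ and $\ast_7$. Its torsion forms are the unique $\tau_0\in C^\infty(M)$, $\tau_1\in\Omega^1(M)$, $\tau_2\in\Omega^2_{14}(M)=\{\beta:\beta\wedge\ast_7\varphi=0\}$, $\tau_3\in\Omega^3_{27}(M)=\{\gamma\in\Omega^3(M):\gamma\wedge\varphi=0,\ \gamma\wedge\ast_7\varphi=0\}$ with $d\varphi=\tau_0\ast_7\varphi+3\tau_1\wedge\varphi+\ast_7\tau_3$ and $d\ast_7\varphi=4\tau_1\wedge\ast_7\varphi+\tau_2\wedge\varphi$. On $M=I_f\times L$, $t$ is the coordinate on $I_f$, primes denote $d/dt$, forms on $L$ and functions of $t$ are identified with their pullbacks; the induced metric is $g_\varphi=f^2g_{\omega,\psi_+}+dt^2$ with volume form $f^6\,\frac16\omega^3\wedge dt$. *)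

(* Defs.v *)
From HB Require Import structures.
From mathcomp Require Import all_boot all_order all_algebra.
From mathcomp Require Import all_classical all_reals all_analysis.
Set Implicit Arguments.
Unset Strict Implicit.
Unset Printing Implicit Defensive.
Import Order.TTheory GRing.Theory Num.Theory.
Import numFieldNormedType.Exports.
Local Open Scope classical_set_scope.
Local Open Scope ring_scope.

(** Exterior algebra of R^n.  An element of [ext R n] is the family of its
    coefficients in the basis dx^S = dx^{s1} /\ ... /\ dx^{sk}, where
    S = {s1 < ... < sk} ranges over the subsets of 'I_n. *)

Definition ext (R : realType) (n : nat) := {ffun {set 'I_n} -> R}.
HB.instance Definition _ (R : realType) (n : nat) := GRing.Lmodule.on (ext R n).

(* dx^A /\ dx^B = wsign A B *: dx^(A :|: B) for disjoint A and B *)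
Definition wsign (R : realType) (n : nat) (A B : {set 'I_n}) : R :=
  (-1) ^+ #|[set p : 'I_n * 'I_n |
               [&& p.1 \in A, p.2 \in B & (p.2 < p.1)%N]]%SET|.

Definition wedge (R : realType) (n : nat) (u v : ext R n) : ext R n :=
  [ffun S : {set 'I_n} =>
     \sum_(A in powerset S) wsign R A (S :\: A) * u A * v (S :\: A)].

Notation "u \wedge v" := (wedge u v) (at level 40, left associativity)
  : ring_scope.

Definition ext1 (R : realType) (n : nat) : ext R n :=
  [ffun S : {set 'I_n} => (S == finset.set0)%:R].

Definition covec (R : realType) (n : nat) (a : 'rV[R]_n) : ext R n :=
  [ffun S : {set 'I_n} => \sum_(i < n) a 0 i * (S == [set i]%SET)%:R].

Definition dx (R : realType) (n : nat) (i : 'I_n) : ext R n :=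
  covec (delta_mx 0 i).

Definition homog (R : realType) (n k : nat) (u : ext R n) : Prop :=
  forall S : {set 'I_n}, u S != 0 -> #|S| = k.

(* Pull-back along the linear map v |-> J v from R^n to R^m (column vectors):
   dx^k is sent to the k-th row of J. *)
Definition pullback (R : realType) (m n : nat) (J : 'M[R]_(m, n))
    (u : ext R m) : ext R n :=
  \sum_(S : {set 'I_m})
     u S *: \big[@wedge R n / ext1 R n]_(k <- enum S) covec (row k J).

(* Hodge star of the inner product with Gram matrix G in the coordinate basis
   and of the volume form vol: u /\ hodge G vol w = <u, w> vol.  Here
   [pullback (invmx G) w] is w with all its indices raised, so that
   <dx^A, w> is its A-coefficient. *)
Definition hodge (R : realType) (n : nat) (G : 'M[R]_n) (vol : ext R n)
    (w : ext R n) : ext R n :=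
  [ffun S : {set 'I_n} =>
     wsign R (~: S)%SET S * pullback (invmx G) w (~: S)%SET
       * vol [set: 'I_n]%SET].

(** SU(3)- and G_2-structures on a vector space.  A coframe is an invertible
    matrix whose rows are the covectors e^1, e^2, ... *)

(* 1-based, as in the mathematical notation *)
Definition cov (R : realType) (n : nat) (E : 'M[R]_n.+1) (k : nat)
  : ext R n.+1 := covec (row (inord k.-1) E).

Section Models.
Context {R : realType}.

Definition su3_omega (E : 'M[R]_6) : ext R 6 :=
  let e := cov E in
  e 1%N \wedge e 2%N + e 3%N \wedge e 4%N + e 5%N \wedge e 6%N.

Definition su3_psip (E : 'M[R]_6) : ext R 6 :=
  let e := cov E in
  e 1%N \wedge e 3%N \wedge e 5%N - e 1%N \wedge e 4%N \wedge e 6%N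
  - e 2%N \wedge e 3%N \wedge e 6%N - e 2%N \wedge e 4%N \wedge e 5%N.

Definition su3_psim (E : 'M[R]_6) : ext R 6 :=
  let e := cov E in
  e 1%N \wedge e 3%N \wedge e 6%N + e 1%N \wedge e 4%N \wedge e 5%N
  + e 2%N \wedge e 3%N \wedge e 5%N - e 2%N \wedge e 4%N \wedge e 6%N.

Definition g2_phi (E : 'M[R]_7) : ext R 7 :=
  let e := cov E in
  e 1%N \wedge e 2%N \wedge e 7%N + e 3%N \wedge e 4%N \wedge e 7%N
  + e 5%N \wedge e 6%N \wedge e 7%N + e 1%N \wedge e 3%N \wedge e 5%N
  - e 1%N \wedge e 4%N \wedge e 6%N - e 2%N \wedge e 3%N \wedge e 6%N
  - e 2%N \wedge e 4%N \wedge e 5%N.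

Definition su3_adapted (om psip psim : ext R 6) (E : 'M[R]_6) : Prop :=
  [/\ E \in unitmx, om = su3_omega E, psip = su3_psip E & psim = su3_psim E].

Definition g2_adapted (phi : ext R 7) (E : 'M[R]_7) : Prop :=
  E \in unitmx /\ phi = g2_phi E.

(* The tensors induced by a structure are read off from an arbitrarily chosen
   adapted coframe; another choice differs by an element of SU(3), resp. G_2,
   and gives the same tensors. *)
Definition su3_coframe (om psip psim : ext R 6) : 'M[R]_6 :=
  xget 0 [set E | su3_adapted om psip psim E].

Definition g2_coframe (phi : ext R 7) : 'M[R]_7 :=
  xget 0 [set E | g2_adapted phi E].

(* Gram matrix of sum_k e^k (x) e^k *)
Definition coframe_metric (n : nat) (E : 'M[R]_n) : 'M[R]_n := E^T *m E.

Definition su3_star (om psip psim : ext R 6) : ext R 6 -> ext R 6 :=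
  hodge (coframe_metric (su3_coframe om psip psim))
        (6^-1 *: (om \wedge om \wedge om)).

(* matrix, acting on column vectors, of J E_1 = E_2, J E_2 = - E_1, etc., where
   (E_k) is the frame dual to the coframe; the forms e^1 + i e^2, etc., are
   then of type (1,0) *)
Definition su3_J (om psip psim : ext R 6) : 'M[R]_6 :=
  let E := su3_coframe om psip psim in
  let J0 : 'M[R]_6 := \matrix_(i, j)
    (if ~~ odd j && (i == j.+1 :> nat) then 1
     else if odd j && (j == i.+1 :> nat) then -1 else 0) in
  invmx E *m J0 *m E.

Definition g2_star (phi : ext R 7) : ext R 7 -> ext R 7 :=
  let e := cov (g2_coframe phi) in
  hodge (coframe_metric (g2_coframe phi))
        (e 1%N \wedge e 2%N \wedge e 3%N \wedge e 4%N \wedge e 5%N \wedge e 6%N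
         \wedge e 7%N).

(* the components Omega^2_8 and Omega^3_12 of an SU(3)-structure *)
Definition su3_type28 (om psip psim b : ext R 6) : Prop :=
  pullback (su3_J om psip psim) b = b /\ b \wedge (om \wedge om) = 0.

Definition su3_type312 (om psip psim c : ext R 6) : Prop :=
  [/\ c \wedge om = 0, c \wedge psip = 0 & c \wedge psim = 0].

(* the components Omega^2_14 and Omega^3_27 of a G_2-structure *)
Definition g2_type214 (phi b : ext R 7) : Prop := b \wedge g2_star phi phi = 0.

Definition g2_type327 (phi c : ext R 7) : Prop :=
  c \wedge phi = 0 /\ c \wedge g2_star phi phi = 0.

End Models.

(** Calculus on open subsets of R^n. *)

Definition partial (R : realType) (n : nat) (i : 'I_n.+1)
    (g : 'rV[R]_n.+1 -> R) (x : 'rV[R]_n.+1) : R :=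
  'D_(delta_mx 0 i : 'rV[R]_n.+1) g x.

Fixpoint Ck (R : realType) (n k : nat) (U : set 'rV[R]_n.+1)
    (g : 'rV[R]_n.+1 -> R) : Prop :=
  if k is k'.+1 then
    (forall x, U x -> differentiable g x) /\
    (forall i, Ck k' U (partial i g))
  else forall x, U x -> {for x, continuous g}.

Definition smooth_on (R : realType) (n : nat) (U : set 'rV[R]_n.+1)
    (g : 'rV[R]_n.+1 -> R) : Prop := forall k, Ck k U g.

Definition smooth_on_interval (R : realType) (I : set R) (g : R -> R) : Prop :=
  forall k t, I t -> derivable (derive1n k g) t 1.

(* d w = sum_i dx^i /\ d_i w *)
Definition ext_d (R : realType) (n : nat) (w : 'rV[R]_n.+1 -> ext R n.+1)
    (x : 'rV[R]_n.+1) : ext R n.+1 :=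
  \sum_(i < n.+1) dx R i \wedge
    ([ffun S : {set 'I_n.+1} => partial i (fun y => w y S) x] : ext R n.+1).

Definition jacobian (R : realType) (m n : nat)
    (F : 'rV[R]_n.+1 -> 'rV[R]_m) (x : 'rV[R]_n.+1) : 'M[R]_(m, n.+1) :=
  \matrix_(k, l) partial l (fun y => F y 0 k) x.

(** Smooth manifolds and differential forms on them. *)

(* [atlas R n T]: charts of T with values in R^(n+1) *)
Record atlas (R : realType) (n : nat) (T : topologicalType) := Atlas {
  chart : Type;
  dom : chart -> set T;
  chart_map : chart -> T -> 'rV[R]_n.+1;
  chart_inv : chart -> 'rV[R]_n.+1 -> T }.

Section Manifolds.
Context {R : realType} {n : nat} {T : topologicalType}.
Implicit Types (A : atlas R n T).

Definition cod A (i : chart A) : set 'rV[R]_n.+1 := chart_map i @` dom i.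

Definition overlap A (i j : chart A) : set 'rV[R]_n.+1 :=
  chart_map i @` (dom i `&` dom j).

Definition transition A (i j : chart A) (x : 'rV[R]_n.+1) : 'rV[R]_n.+1 :=
  chart_map j (chart_inv i x).

Definition homeo_chart A (i : chart A) : Prop :=
  [/\ open (dom i), open (cod i),
      forall p, dom i p -> chart_inv i (chart_map i p) = p,
      forall p, dom i p -> {for p, continuous (chart_map i)} &
      forall x, cod i x -> {for x, continuous (chart_inv i)}].

Definition smooth_manifold A : Prop :=
  [/\ hausdorff_space T, @second_countable T,
      forall p : T, exists i : chart A, dom i p,
      forall i : chart A, homeo_chart i &
      forall (i j : chart A) k,
        smooth_on (overlap i j) (fun x => transition i j x 0 k)].

(* Chartwise sections: the values at x matter only for x in [cod i]. *)
Definition scalar_field A := chart A -> 'rV[R]_n.+1 -> R.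
Definition ext_field A := chart A -> 'rV[R]_n.+1 -> ext R n.+1.

Definition smooth_function A (h : scalar_field A) : Prop :=
  (forall i, smooth_on (cod i) (h i)) /\
  (forall i j x, overlap i j x -> h i x = h j (transition i j x)).

Definition diff_form A (k : nat) (w : ext_field A) : Prop :=
  [/\ forall i (S : {set 'I_n.+1}), smooth_on (cod i) (fun x => w i x S),
      forall i x, cod i x -> homog k (w i x) &
      forall i j x, overlap i j x ->
        w i x = pullback (jacobian (transition i j) x)
                         (w j (transition i j x))].

End Manifolds.

(** SU(3)-structures on 6-manifolds and their torsion forms. *)

Section SU3.
Context {R : realType} {T : topologicalType}.

Definition su3_structure (L : atlas R 5 T) (om psip psim : ext_field L)
    : Prop :=
  [/\ diff_form 2 om, diff_form 3 psip, diff_form 3 psim &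
      forall i x, cod i x ->
        exists U : set 'rV[R]_6, exists E : 'rV[R]_6 -> 'M[R]_6,
          [/\ open U, U x, U `<=` cod i,
              forall k l, smooth_on U (fun y => E y k l) &
              forall y, U y ->
                su3_adapted (om i y) (psip i y) (psim i y) (E y)]].

Definition su3_torsion (L : atlas R 5 T) (om psip psim : ext_field L)
    (pi0 sigma0 : scalar_field L)
    (pi1 nu1 pi2 sigma2 nu3 : ext_field L) : Prop :=
  [/\ smooth_function pi0 /\ smooth_function sigma0,
      diff_form 1 pi1 /\ diff_form 1 nu1,
      diff_form 2 pi2 /\ diff_form 2 sigma2,
      diff_form 3 nu3 &
      forall i x, cod i x ->
        let o := om i x in let p := psip i x in let m := psim i x in
        [/\ su3_type28 o p m (pi2 i x) /\ su3_type28 o p m (sigma2 i x),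
            su3_type312 o p m (nu3 i x),
            ext_d (om i) x =
              - (3 / 2 * sigma0 i x) *: p + (3 / 2 * pi0 i x) *: m
              + nu1 i x \wedge o + nu3 i x,
            ext_d (psip i) x =
              pi0 i x *: (o \wedge o) + pi1 i x \wedge p - pi2 i x \wedge o &
            ext_d (psim i) x =
              sigma0 i x *: (o \wedge o) + pi1 i x \wedge m
              - sigma2 i x \wedge o]].

End SU3.

(** Torsion forms of a G_2-structure on a 7-manifold.  The system below
    determines tau0, ..., tau3 pointwise among arbitrary, not necessarily
    smooth, sections; no regularity is therefore built in. *)

Definition g2_torsion (R : realType) (T : topologicalType) (M : atlas R 6 T)
    (phi : ext_field M) (tau0 : scalar_field M)
    (tau1 tau2 tau3 : ext_field M) : Prop :=
  forall i x, cod i x ->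
    let star := g2_star (phi i x) in
    [/\ [/\ homog 1 (tau1 i x), homog 2 (tau2 i x) & homog 3 (tau3 i x)],
        g2_type214 (phi i x) (tau2 i x),
        g2_type327 (phi i x) (tau3 i x),
        ext_d (phi i) x =
          tau0 i x *: star (phi i x) + 3 *: (tau1 i x \wedge phi i x)
          + star (tau3 i x) &
        ext_d (fun y => g2_star (phi i y) (phi i y)) x =
          4 *: (tau1 i x \wedge star (phi i x)) + tau2 i x \wedge phi i x].

(** The product of a manifold with an interval I; the coordinate t of the
    second factor is the last one. *)

Section Cylinder.
Context {R : realType} {n : nat}.

Definition join_t (x : 'rV[R]_n.+1) (t : R) : 'rV[R]_n.+2 :=
  \row_j (if unlift ord_max j is Some k then x 0 k else t).

Definition base (z : 'rV[R]_n.+2) : 'rV[R]_n.+1 :=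
  \row_k z 0 (lift ord_max k).

Definition time (z : 'rV[R]_n.+2) : R := z 0 ord_max.

Definition cylinder (T : topologicalType) (I : set R) (A : atlas R n T)
    : atlas R n.+1 (T * R)%type :=
  @Atlas R n.+1 (T * R)%type (chart A)
    (fun i => dom i `*` I)
    (fun i q => join_t (chart_map i q.1) q.2)
    (fun i z => (chart_inv i (base z), time z)).

(* pull-back along the projection (x, t) |-> x *)
Definition from_base (u : ext R n.+1) : ext R n.+2 :=
  pullback (\matrix_(k, j) (j == lift ord_max k)%:R) u.

Definition dt : ext R n.+2 := dx R ord_max.

End Cylinder.

(* f^2 omega /\ dt + f^3 (alpha psi_+ - beta psi_-) *)
Definition warped_g2 (R : realType) (T : topologicalType) (I : set R)
    (L : atlas R 5 T) (f alpha beta : R -> R) (om psip psim : ext_field L)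
    : ext_field (cylinder I L) :=
  fun i z =>
    let x := base z in let t := time z in
    f t ^+ 2 *: (from_base (om i x) \wedge dt)
    + f t ^+ 3 *: (alpha t *: from_base (psip i x)
                   - beta t *: from_base (psim i x)).

(* Main.v *)
(** The G_2-tensors are read off an arbitrarily chosen adapted coframe; they do
    not depend on it, because [contract i phi /\ contract j phi /\ phi] is six
    times the metric coefficient times the volume form, so that an automorphism
    of [phi] is orthogonal of determinant one.  The star of the warped structure
    may therefore be computed in the coframe f e^1, ..., f e^6, dt, where
    e^1 + i e^2 has been multiplied by alpha + i beta: it acts on the
    pull-backs of k-forms from L as [su3_star], up to a power of f and a wedge
    with dt.

    Splitting forms and exterior derivatives along L and dt, the torsion system
    becomes four equations between forms on L, which hold for the given formulas
    by identities between [su3_star], omega and psi_+-.  Each of these identities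
    is linear in a single unknown form, hence is checked on monomials, with
    integer coefficients, by evaluation.  Conversely [star (b /\ phi) = - b] for
    b in Omega^2_14, so the equation for [d (star phi)] determines tau_1, hence
    tau_2; the equation for [d phi] then determines tau_0 and tau_3. *)

Require Import Defs.
From HB Require Import structures.
From mathcomp Require Import all_boot all_order all_algebra.
From mathcomp Require Import all_classical all_reals all_analysis.
From mathcomp Require Import ring.
Set Implicit Arguments.
Unset Strict Implicit.
Unset Printing Implicit Defensive.
Import Order.TTheory GRing.Theory Num.Theory.
Import numFieldNormedType.Exports.
Local Open Scope ring_scope.

(** * The exterior algebra *)

(** The coframe behind [g2_star] and [su3_star] is chosen separately at every point, with no
    continuity, so nothing built from it can be differentiated directly. Only [star phi] raises the
    problem: it is first rewritten near the point as a combination of omega /\ omega and psi_+- /\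
    dt with coefficients depending on t, and the torsion equations of L then supply the derivatives.
    The rest is linear algebra at one point, transported to the standard coframe by pull-back. An
    identity valid only on Omega^2_8 or Omega^2_14 cannot be tested on monomials, which lie outside
    these spaces. Each is made unconditional by adding terms that vanish on the subspace, such as
    multiples of b - J b, or terms built from b /\ omega^2. *)

Section Sign.
Context {R : realType} {n : nat}.
Implicit Types (A B C S : {set 'I_n}) (i j : 'I_n).
Local Notation sg := (@wsign R n).

(** As a double product of signs, the inversion count is visibly multiplicative under disjoint
    unions in either argument. *)
Lemma wsignE A B : sg A B = \prod_(i in A) \prod_(j in B) (-1) ^+ (j < i)%N.
Proof.
transitivity (\prod_(i in A) \prod_(j in B | (j < i)%N) (-1 : R)).
  rewrite pair_big_dep /= prodr_const /wsign; congr (_ ^+ _).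
  by apply: eq_card => p; rewrite inE.
apply: eq_bigr => i _; rewrite big_mkcondr; apply: eq_bigr => j _.
by case: ifP.
Qed.

Lemma wsign_sqr A B : sg A B * sg A B = 1.
Proof. by rewrite /wsign -expr2 sqrr_sign. Qed.

Lemma wsign0l B : sg finset.set0 B = 1.
Proof. by rewrite wsignE big_set0. Qed.

Lemma wsign0r A : sg A finset.set0 = 1.
Proof. by rewrite wsignE big1 // => i _; rewrite big_set0. Qed.

Lemma prod_disjointU (F : 'I_n -> R) A B : [disjoint A & B] ->
  \prod_(i in A :|: B) F i = \prod_(i in A) F i * \prod_(i in B) F i.
Proof.
by move=> dAB; rewrite (eq_bigl [predU A & B]) ?bigU // => i; rewrite !inE.
Qed.

Lemma wsignUl A B C : [disjoint A & B] -> sg (A :|: B) C = sg A C * sg B C.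
Proof. by move=> dAB; rewrite !wsignE prod_disjointU. Qed.

Lemma wsignUr A B C : [disjoint B & C] -> sg A (B :|: C) = sg A B * sg A C.
Proof.
by move=> dBC; rewrite !wsignE -big_split; apply: eq_bigr => i _; rewrite prod_disjointU.
Qed.

(** Each of the #|A| * #|B| pairs is an inversion in exactly one of the two orders. *)
Lemma wsignC A B : [disjoint A & B] -> sg A B * sg B A = (-1) ^+ (#|A| * #|B|).
Proof.
move=> dAB; rewrite !wsignE [X in _ * X]exchange_big /= -big_split /=.
rewrite mulnC exprM -[RHS]prodr_const.
apply: eq_bigr => i iA; rewrite -big_split -prodr_const /=.
apply: eq_bigr => j jB; rewrite -exprD.
have : i != j by apply: contraTneq jB => <-; rewrite (disjointFr dAB iA).
by rewrite -val_eqE neq_ltn; case: ltngtP.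
Qed.

End Sign.

Section Wedge.
Context {R : realType} {n : nat}.
Implicit Types (u v w : ext R n) (A B C S : {set 'I_n}) (i j : 'I_n) (c : R).
Local Notation sg := (@wsign R n).

Definition bas S : ext R n := [ffun S' : {set 'I_n} => (S' == S)%:R].

Lemma basE S S' : bas S S' = (S' == S)%:R.
Proof. by rewrite ffunE. Qed.

Lemma extD u v S : (u + v) S = u S + v S. Proof. by rewrite ffunE. Qed.
Lemma extN u S : (- u) S = - u S. Proof. by rewrite ffunE. Qed.
Lemma extZ c u S : (c *: u) S = c * u S. Proof. by rewrite ffunE. Qed.
Lemma ext0 S : (0 : ext R n) S = 0. Proof. by rewrite ffunE. Qed.
Lemma ext_sum (J : Type) (r : seq J) (P : pred J) (F : J -> ext R n) S :
  (\sum_(j <- r | P j) F j) S = \sum_(j <- r | P j) F j S.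
Proof.
by elim/big_rec2: _ => [|j y x _ <-]; rewrite ?ext0 ?extD.
Qed.
Definition extE := (extD, extN, extZ, ext0, basE).

Lemma ext_basis u : u = \sum_S u S *: bas S.
Proof.
apply/ffunP => S; rewrite ext_sum (bigD1 S) //= extZ basE eqxx mulr1 big1 ?addr0 //.
by move=> S' /negPf; rewrite extZ basE eq_sym => ->; rewrite mulr0.
Qed.

Lemma wedgeDl u v w : (u + v) \wedge w = u \wedge w + v \wedge w.
Proof.
apply/ffunP => S; rewrite extD !ffunE -big_split.
by apply: eq_bigr => A _; rewrite extD /=; ring.
Qed.
Lemma wedgeDr u v w : u \wedge (v + w) = u \wedge v + u \wedge w.
Proof.
apply/ffunP => S; rewrite extD !ffunE -big_split.
by apply: eq_bigr => A _; rewrite extD /=; ring.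
Qed.
Lemma wedgeZl c u v : (c *: u) \wedge v = c *: (u \wedge v).
Proof.
apply/ffunP => S; rewrite extZ !ffunE mulr_sumr.
by apply: eq_bigr => A _; rewrite extZ; ring.
Qed.
Lemma wedgeZr c u v : u \wedge (c *: v) = c *: (u \wedge v).
Proof.
apply/ffunP => S; rewrite extZ !ffunE mulr_sumr.
by apply: eq_bigr => A _; rewrite extZ; ring.
Qed.

HB.instance Definition _ u :=
  GRing.isLinear.Build R (ext R n) (ext R n) *:%R (wedge u)
    (fun c v w => etrans (wedgeDr u (c *: v) w) (f_equal2 +%R (wedgeZr c u v) (erefl _))).

(** Multiplication is linear in each argument; the flipped product carries the linear structure in
    the first one, so that [linear_ext_eq] can be applied there too. *)
Definition wedger v u := u \wedge v.
HB.instance Definition _ v :=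
  GRing.isLinear.Build R (ext R n) (ext R n) *:%R (wedger v)
    (fun c u w => etrans (wedgeDl (c *: u) w v) (f_equal2 +%R (wedgeZl c u v) (erefl _))).

Lemma wedge0l u : 0 \wedge u = 0. Proof. exact: (linear0 (wedger u)). Qed.
Lemma wedge0r u : u \wedge 0 = 0. Proof. exact: linear0. Qed.
Lemma wedgeNl u v : (- u) \wedge v = - (u \wedge v).
Proof. exact: (linearN (wedger v)). Qed.
Lemma wedgeNr u v : u \wedge (- v) = - (u \wedge v). Proof. exact: linearN. Qed.
Lemma wedgeBl u v w : (u - v) \wedge w = u \wedge w - v \wedge w.
Proof. exact: (linearB (wedger w)). Qed.
Lemma wedge_suml (J : Type) (r : seq J) (P : pred J) (F : J -> ext R n) v :
  (\sum_(j <- r | P j) F j) \wedge v = \sum_(j <- r | P j) F j \wedge v.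
Proof. exact: (linear_sum (wedger v)). Qed.
Lemma wedge_sumr (J : Type) (r : seq J) (P : pred J) (F : J -> ext R n) v :
  v \wedge (\sum_(j <- r | P j) F j) = \sum_(j <- r | P j) v \wedge F j.
Proof. exact: linear_sum. Qed.

Lemma linear_ext_eq (V : lmodType R) (F G : {linear ext R n -> V}) :
  (forall S, F (bas S) = G (bas S)) -> F =1 G.
Proof.
move=> FG u; rewrite (ext_basis u) !linear_sum.
by apply: eq_bigr => S _; rewrite !linearZ_LR /= FG.
Qed.

Lemma bas_wedgeE A v S :
  (bas A \wedge v) S = (A \subset S)%:R * (sg A (S :\: A) * v (S :\: A)).
Proof.
rewrite ffunE; case: (boolP (A \subset S)) => AS.
  rewrite (bigD1 A) ?inE //= basE eqxx mulr1 mul1r big1 ?addr0 // => B /andP[_ /negPf BA].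
  by rewrite basE BA mulr0 mul0r.
rewrite mul0r big1 // => B; rewrite inE => BS.
rewrite basE; case: eqP => [BA|_]; last by rewrite mulr0 mul0r.
by rewrite -BA BS in AS.
Qed.

Lemma bas_wedge A B :
  bas A \wedge bas B = [disjoint A & B]%:R *: (sg A B *: bas (A :|: B)).
Proof.
apply/ffunP => S; rewrite bas_wedgeE !extE.
case: (boolP (S == A :|: B)) => [/eqP->|neS].
  rewrite finset.subsetUl mul1r mulr1 finset.setDUl finset.setDv finset.set0U.
  case: (boolP [disjoint A & B]) => dAB.
    by move: dAB; rewrite disjoint_sym => /finset.setDidPl->; rewrite eqxx mulr1 mul1r.
  rewrite mul0r; case: eqP; rewrite ?mulr0 // => /finset.setDidPl; rewrite disjoint_sym.
  by rewrite (negPf dAB).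
rewrite !mulr0; case: (boolP (A \subset S)) => AS; last by rewrite mul0r.
case: eqP => [SAB|]; last by rewrite !mulr0.
by move: neS; rewrite -SAB finset.setUC -{1}(finset.setID S A) (finset.setIidPr AS)
  finset.setUC eqxx.
Qed.

Lemma set_disjointUr A B C :
  [disjoint A & B :|: C] = [disjoint A & B] && [disjoint A & C].
Proof.
by rewrite !finset.disjoints_subset finset.setCU finset.subsetI.
Qed.

Lemma set_disjointUl A B C :
  [disjoint A :|: B & C] = [disjoint A & C] && [disjoint B & C].
Proof. by rewrite ![[disjoint _ & C]]disjoint_sym set_disjointUr. Qed.

(** Both sides are trilinear, so monomials suffice, and there the claim is the multiplicativity of
    the sign. [linear_ext_eq] is used once per argument. *)
Lemma wedgeA u v w : u \wedge (v \wedge w) = u \wedge v \wedge w.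
Proof.
move: u; apply: (@linear_ext_eq _ (wedger (v \wedge w)) (wedger w \o wedger v)) => A /=.
rewrite /wedger; move: v.
apply: (@linear_ext_eq _ (wedge (bas A) \o wedger w) (wedger w \o wedge (bas A))) => B /=.
rewrite /wedger; move: w.
apply: (@linear_ext_eq _ (wedge (bas A) \o wedge (bas B)) (wedge (bas A \wedge bas B))) => C /=.
rewrite !bas_wedge !(wedgeZr, wedgeZl) !bas_wedge set_disjointUr set_disjointUl.
have [dAB|] := boolP [disjoint A & B]; last by rewrite !scale0r !scaler0.
have [dBC|] := boolP [disjoint B & C]; last by rewrite andbF !scale0r !scaler0.
have [dAC|] := boolP [disjoint A & C]; last by rewrite !scale0r !scaler0.
rewrite !scale1r !scalerA wsignUl // wsignUr // finset.setUA.
by congr (_ *: _); ring.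
Qed.

Lemma ext1E : ext1 R n = bas finset.set0.
Proof. by apply/ffunP => S; rewrite !ffunE. Qed.

Lemma wedge1l u : ext1 R n \wedge u = u.
Proof.
apply/ffunP => S; rewrite ext1E bas_wedgeE finset.sub0set mul1r finset.setD0.
by rewrite wsign0l mul1r.
Qed.

Lemma wedge1r u : u \wedge ext1 R n = u.
Proof.
rewrite ext1E; move: u.
apply: (@linear_ext_eq _ (wedger (bas finset.set0)) idfun) => A /=.
by rewrite /wedger bas_wedge finset.disjoints_subset finset.setC0 finset.subsetT wsign0r
  !scale1r finset.setU0.
Qed.

HB.instance Definition _ :=
  Monoid.isLaw.Build (ext R n) (ext1 R n) (@wedge R n) wedgeA wedge1l wedge1r.

Lemma covecE (a : 'rV[R]_n) : covec a = \sum_i a 0 i *: bas [set i]%SET.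
Proof.
by apply/ffunP => S; rewrite ffunE ext_sum; apply: eq_bigr => i _; rewrite !ffunE.
Qed.

Lemma dxE i : dx R i = bas [set i]%SET.
Proof.
rewrite /dx covecE (bigD1 i) //= mxE !eqxx scale1r big1 ?addr0 // => j /negPf ji.
by rewrite mxE ji andbF scale0r.
Qed.

Lemma covec_linear : linear (@covec R n).
Proof.
move=> c a b; rewrite !covecE scaler_sumr -big_split.
by apply: eq_bigr => i _; rewrite !mxE scalerDl scalerA.
Qed.
HB.instance Definition _ := GRing.isLinear.Build R 'rV[R]_n (ext R n) *:%R (@covec R n)
  covec_linear.

Lemma covec_sum_dx (a : 'rV[R]_n) : covec a = \sum_i a 0 i *: dx R i.
Proof. by rewrite covecE; apply: eq_bigr => i _; rewrite dxE. Qed.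

Lemma homog_bas S : homog #|S| (bas S).
Proof. by move=> S'; rewrite basE; have [->|] := eqVneq S' S; rewrite // eqxx. Qed.

Lemma homogP k u : homog k u <-> u = \sum_(S : {set 'I_n} | #|S| == k) u S *: bas S.
Proof.
split=> [hu|-> S].
  rewrite [LHS]ext_basis (bigID (fun S : {set 'I_n} => #|S| == k)) /= [X in _ + X]big1 ?addr0
    //.
  move=> S; apply: contraNeq; rewrite scaler_eq0 negb_or => /andP[/hu -> _]; exact: eqxx.
rewrite ext_sum => /eqP; apply: contra_notP => Sk; apply: big1 => S' /eqP Sk'.
rewrite extE basE; case: eqP; rewrite ?mulr0 // => SS'; by rewrite SS' in Sk.
Qed.

Lemma homogD k u v : homog k u -> homog k v -> homog k (u + v).
Proof.
move=> hu hv S; rewrite extD => uv; have [/hu//|] := boolP (u S != 0); rewrite negbK => /eqP u0.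
by apply: hv; move: uv; rewrite u0 add0r.
Qed.
Lemma homogZ k c u : homog k u -> homog k (c *: u).
Proof. by move=> hu S; rewrite extZ mulf_eq0 negb_or => /andP[_ /hu]. Qed.
Lemma homog0 k : homog k (0 : ext R n).
Proof. by move=> S; rewrite ext0 eqxx. Qed.
Lemma homogN k u : homog k u -> homog k (- u).
Proof. by move=> hu; rewrite -scaleN1r; apply: homogZ. Qed.
Lemma homogB k u v : homog k u -> homog k v -> homog k (u - v).
Proof. by move=> hu hv; apply: homogD => //; apply: homogN. Qed.
Lemma homog_sum k (J : Type) (r : seq J) (P : pred J) (F : J -> ext R n) :
  (forall j : J, P j -> homog k (F j)) -> homog k (\sum_(j <- r | P j) F j).
Proof.
move=> hF; elim/big_rec: _ => [|j x Pj]; first exact: homog0.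
by apply: homogD; apply: hF.
Qed.

Lemma homog_wedge k l u v : homog k u -> homog l v -> homog (k + l) (u \wedge v).
Proof.
move=> /homogP-> /homogP->; rewrite wedge_suml; apply: homog_sum => A /eqP Ak.
rewrite wedge_sumr; apply: homog_sum => B /eqP Bl.
rewrite wedgeZl wedgeZr bas_wedge; do 2!apply: homogZ.
case: (boolP [disjoint A & B]) => dAB; last by rewrite scale0r; exact: homog0.
do 2!apply: homogZ; rewrite -Ak -Bl; have := @homog_bas (A :|: B).
by rewrite finset.cardsU (finset.disjoint_setI0 dAB) cards0 subn0.
Qed.

Lemma homog_covec (a : 'rV[R]_n) : homog 1 (covec a).
Proof.
rewrite covecE; apply: homog_sum => i _; apply: homogZ; have := @homog_bas [set i]%SET.
by rewrite cards1.
Qed.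

Lemma wedgeC k l u v : homog k u -> homog l v ->
  u \wedge v = (-1) ^+ (k * l) *: (v \wedge u).
Proof.
move=> /homogP-> /homogP->; rewrite !wedge_suml scaler_sumr.
under [RHS]eq_bigr => B _ do rewrite wedge_sumr scaler_sumr.
rewrite exchange_big /=; apply: eq_bigr => A /eqP Ak.
rewrite wedge_sumr; apply: eq_bigr => B /eqP Bl.
rewrite !(wedgeZl, wedgeZr) !bas_wedge [in RHS]disjoint_sym finset.setUC.
case: (boolP [disjoint A & B]) => dAB; last by rewrite !scale0r !scaler0.
rewrite !scalerA -Ak -Bl -wsignC // mulrACA.
have := wsign_sqr B A (R := R); set s := sg _ _; set t := sg _ _ => st; congr (_ *: _).
by ring: st.
Qed.

Lemma covecC (a b : 'rV[R]_n) : covec a \wedge covec b = - (covec b \wedge covec a).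
Proof. by rewrite (wedgeC (@homog_covec a) (@homog_covec b)) expr1 scaleN1r. Qed.

Lemma covec_sqr (a : 'rV[R]_n) : covec a \wedge covec a = 0.
Proof. by have := covecC a a => /eqP; rewrite -addr_eq0 -mulr2n -scaler_nat scaler_eq0
  pnatr_eq0 => /eqP. Qed.

End Wedge.

(** * Pull-backs *)

Section OrderedProducts.
Context {R : realType} {n m : nat}.
Variable (c : 'I_n -> ext R m).
Hypothesis c_anticomm : forall i j, c i \wedge c j = - (c j \wedge c i).
Implicit Types (s : seq 'I_n) (P : pred 'I_n) (i j : 'I_n) (S : {set 'I_n}).
Local Notation "\bigw_ ( i <- r | P ) F" := (\big[@wedge R m/ext1 R m]_(i <- r | P) F)
  (at level 36, F at level 36, i, r at level 50).

Lemma anticomm_sqr i : c i \wedge c i = 0.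
Proof.
by have := c_anticomm i i => /eqP; rewrite -addr_eq0 -mulr2n -scaler_nat scaler_eq0 pnatr_eq0
  => /eqP.
Qed.

Lemma wedge_bigw_mem s P i : i \in s -> P i -> c i \wedge \bigw_(k <- s | P k) c k = 0.
Proof.
elim: s => // k s IH; rewrite inE => /predU1P[<- Pi|/IH{}IH /[dup] Pi /IH{}IH].
  by rewrite big_cons Pi wedgeA anticomm_sqr wedge0l.
rewrite big_cons; case: ifP => // _.
by rewrite wedgeA c_anticomm wedgeNl -wedgeA IH wedge0r oppr0.
Qed.

(** Moving [c i] to its place in the increasing product passes exactly the smaller factors, each at
    the cost of one sign. *)
Lemma wedge_bigw_notin s P i : sorted (fun a b : 'I_n => a < b)%N s -> i \in s -> ~~ P i ->
  c i \wedge \bigw_(k <- s | P k) c k =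
  (\prod_(k <- s | P k) (-1) ^+ (k < i)%N) *: \bigw_(k <- s | P k || (k == i)) c k.
Proof.
move=> + + Pi; elim: s => // k s IH /[dup] /path_sorted ss; rewrite /= path_sortedE; last first.
  by move=> a b d; apply: ltn_trans.
move=> /andP[/allP ks _]; rewrite inE => /predU1P[ik|iins].
  rewrite -ik !big_cons (negPf Pi) eqxx /=.
  have lts (j : 'I_n) : j \in s -> (i < j)%N by rewrite ik; exact: ks.
  rewrite [X in X *: _]big1_seq ?scale1r; last first.
    by move=> j /andP[_ /lts]; case: ltngtP.
  congr (_ \wedge _); rewrite big_seq_cond [RHS]big_seq_cond.
  apply: eq_bigl => j; have [/= /lts|//] := boolP (j \in s).
  by rewrite -val_eqE /=; case: ltngtP => // _ _; rewrite orbF.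
have ki := ks i iins.
have neki : k == i = false by apply: negbTE; rewrite -val_eqE neq_ltn ki.
rewrite !big_cons neki orbF; case: ifP => Pk; last exact: IH.
by rewrite wedgeA c_anticomm wedgeNl -wedgeA IH // wedgeZr ki expr1 mulN1r scaleNr.
Qed.

Lemma sorted_index_enum : sorted (fun a b : 'I_n => a < b)%N (index_enum 'I_n).
Proof.
have : sorted ltn (map val (enum 'I_n)) by rewrite val_enum_ord iota_ltn_sorted.
by rewrite sorted_map enumT.
Qed.

(** Any anticommuting family obeys the rule that [dx_bas] states for the coordinate covectors.
    Taking for the family the [dx] themselves, and then the rows of a matrix, identifies [bas S]
    with an ordered product and makes pull-back multiplicative. *)
Lemma wedge_bigw_enum i S :
  c i \wedge \bigw_(k <- enum S | true) c k =
  if i \in S then 0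
  else wsign R [set i]%SET S *: \bigw_(k <- enum (i |: S)%SET | true) c k.
Proof.
rewrite /enum_mem !big_filter /= -!enumT.
case: ifPn => iS; first by apply: wedge_bigw_mem; rewrite ?mem_enum.
rewrite wedge_bigw_notin ?mem_enum // ?enumT ?sorted_index_enum //.
rewrite wsignE big_set1; congr (_ *: _).
by apply: eq_bigl => k; rewrite !inE orbC.
Qed.

End OrderedProducts.

Section Pullback.
Context {R : realType}.

Lemma dx_bas n (i : 'I_n) (S : {set 'I_n}) :
  dx R i \wedge bas S =
  if i \in S then 0 else wsign R [set i]%SET S *: bas (i |: S)%SET.
Proof.
by rewrite dxE bas_wedge disjoints1; case: ifP; rewrite /= ?scale0r ?scale1r.
Qed.

Lemma set_ind_add n (P : {set 'I_n} -> Prop) : P finset.set0 ->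
  (forall i (S : {set 'I_n}), i \notin S -> P S -> P (i |: S)%SET) -> forall S, P S.
Proof.
move=> P0 PS S; have [k] := ubnP #|S|; elim: k S => // k IH S Sk.
have [->//|/set0Pn[i iS]] := eqVneq S finset.set0.
rewrite -(finset.setD1K iS); apply: PS; first by rewrite !inE eqxx.
by apply: IH; move: Sk; rewrite (cardsD1 i) iS.
Qed.

Lemma bigw_dx n (S : {set 'I_n}) : \big[@wedge R n/ext1 R n]_(k <- enum S) dx R k = bas S.
Proof.
elim/set_ind_add: S => [|i S iS IH]; first by rewrite finset.enum_set0 big_nil ext1E.
have := wedge_bigw_enum (fun i j => covecC (delta_mx 0 i) (delta_mx 0 j : 'rV[R]_n)) i S.
rewrite -/(dx R i) (negPf iS) IH dx_bas (negPf iS) => /(congr1 (fun u => wsign R [set i]%SET S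
  *: u)).
by rewrite !scalerA wsign_sqr !scale1r.
Qed.

(** The covectors [dx i] generate the algebra. Induction along this presentation avoids index sets:
    a statement about pull-backs has to be checked only for one more left factor. *)
Lemma ext_ind n (P : ext R n -> Prop) :
  P (ext1 R n) -> (forall i u, P u -> P (dx R i \wedge u)) ->
  (forall c u v, P u -> P v -> P (c *: u + v)) -> forall u, P u.
Proof.
move=> P1 Pdx Plin u.
have P0 : P 0 by rewrite -(addNr (ext1 R n)) -scaleN1r; apply: Plin.
have Pbas S : P (bas S).
  by rewrite -bigw_dx; elim: (enum S) => [|k s IH]; rewrite ?big_nil ?big_cons //; apply: Pdx.
rewrite (ext_basis u); elim/big_rec: _ => // S v _; exact: Plin.
Qed.

Lemma pullback_is_linear m n (J : 'M[R]_(m, n)) : linear (pullback J).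
Proof.
move=> c u v; rewrite /pullback scaler_sumr -big_split; apply: eq_bigr => S _.
by rewrite !extE scalerDl scalerA.
Qed.
HB.instance Definition _ m n (J : 'M[R]_(m, n)) :=
  GRing.isLinear.Build R (ext R m) (ext R n) *:%R (pullback J) (pullback_is_linear J).

Lemma pullback_bas m n (J : 'M[R]_(m, n)) S :
  pullback J (bas S) = \big[@wedge R n/ext1 R n]_(k <- enum S) covec (row k J).
Proof.
rewrite /pullback (bigD1 S) //= basE eqxx scale1r [X in _ + X]big1 ?addr0 // => S' /negPf S'S.
by rewrite basE S'S scale0r.
Qed.

Lemma pullback_ext1 m n (J : 'M[R]_(m, n)) : pullback J (ext1 R m) = ext1 R n.
Proof. by rewrite ext1E pullback_bas finset.enum_set0 big_nil. Qed.

Lemma pullback_dx_wedge m n (J : 'M[R]_(m, n)) i u :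
  pullback J (dx R i \wedge u) = covec (row i J) \wedge pullback J u.
Proof.
move: u; apply: (@linear_ext_eq _ _ _ (pullback J \o wedge (dx R i))
   (wedge (covec (row i J)) \o pullback J)) => S /=.
rewrite dx_bas [in RHS]pullback_bas.
rewrite (wedge_bigw_enum (fun i j => covecC (row i J) (row j J))).
by case: ifP => _; rewrite ?linear0 // linearZ /= pullback_bas.
Qed.

Lemma pullback_dx m n (J : 'M[R]_(m, n)) i : pullback J (dx R i) = covec (row i J).
Proof. by rewrite -[dx R i]wedge1r pullback_dx_wedge pullback_ext1 wedge1r. Qed.

Lemma pullback_covec m n (J : 'M[R]_(m, n)) (a : 'rV[R]_m) :
  pullback J (covec a) = covec (a *m J).
Proof.
rewrite covec_sum_dx linear_sum mulmx_sum_row linear_sum; apply: eq_bigr => i _.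
by rewrite !linearZ /= pullback_dx.
Qed.

Lemma pullbackM m n (J : 'M[R]_(m, n)) u v :
  pullback J (u \wedge v) = pullback J u \wedge pullback J v.
Proof.
elim/ext_ind: u => [|i u IH|c u w IHu IHw].
- by rewrite pullback_ext1 !wedge1l.
- by rewrite -wedgeA !pullback_dx_wedge IH wedgeA.
- by rewrite wedgeDl wedgeZl !linearP /= IHu IHw wedgeDl wedgeZl.
Qed.

Lemma pullback_comp m n p (J : 'M[R]_(m, n)) (K : 'M[R]_(n, p)) u :
  pullback K (pullback J u) = pullback (J *m K) u.
Proof.
elim/ext_ind: u => [|i u IH|c u w IHu IHw].
- by rewrite !pullback_ext1.
- by rewrite !pullback_dx_wedge pullbackM pullback_covec row_mul IH.
- by rewrite !linearP /= IHu IHw.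
Qed.

Lemma pullback_id n (u : ext R n) : pullback 1%:M u = u.
Proof.
elim/ext_ind: u => [|i u IH|c u w IHu IHw].
- by rewrite pullback_ext1.
- by rewrite pullback_dx_wedge IH row1.
- by rewrite linearP /= IHu IHw.
Qed.

Lemma pullbackK n (E : 'M[R]_n) : E \in unitmx -> cancel (pullback E) (pullback (invmx E)).
Proof. by move=> uE u; rewrite pullback_comp mulmxV // pullback_id. Qed.

Lemma pullbackVK n (E : 'M[R]_n) : E \in unitmx -> cancel (pullback (invmx E)) (pullback E).
Proof. by move=> uE u; rewrite pullback_comp mulVmx // pullback_id. Qed.

Lemma homog_ext1 n : homog 0 (ext1 R n).
Proof. by rewrite ext1E; have := @homog_bas R n finset.set0; rewrite cards0. Qed.

Lemma homog_pullback m n (J : 'M[R]_(m, n)) k u : homog k u -> homog k (pullback J u).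
Proof.
move=> /homogP->; rewrite linear_sum; apply: homog_sum => S /eqP <-.
rewrite linearZ; apply: homogZ; rewrite /= pullback_bas cardE.
elim: (enum S) => [|i s IH]; rewrite ?big_nil ?big_cons; first exact: homog_ext1.
exact: (homog_wedge (@homog_covec _ _ _) IH).
Qed.

Lemma pullback_scale m n (J : 'M[R]_(m, n)) c k u : homog k u ->
  pullback (c *: J) u = c ^+ k *: pullback J u.
Proof.
move=> /homogP->; rewrite ![pullback _ _]linear_sum scaler_sumr; apply: eq_bigr => S /eqP <-.
rewrite /= ![pullback _ (_ *: _)]linearZ /= scalerA mulrC -scalerA; congr (_ *: _);
  rewrite !pullback_bas cardE.
elim: (enum S) => [|i s IH]; rewrite ?big_nil ?big_cons ?scale1r //=.
have -> : row i (c *: J) = c *: row i J by apply/rowP => j; rewrite !mxE.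
by rewrite IH [covec (_ *: _)]linearZ /= wedgeZl wedgeZr scalerA exprS.
Qed.

End Pullback.

(** * Contractions and the Hodge star *)

Section Contraction.
Context {R : realType}.

Lemma pullback_sum m n (J : 'M[R]_(m, n)) (T : Type) (r : seq T) (P : pred T) (F : T -> ext R
  m) :
  pullback J (\sum_(j <- r | P j) F j) = \sum_(j <- r | P j) pullback J (F j).
Proof. exact: linear_sum. Qed.

Lemma pullbackZ m n (J : 'M[R]_(m, n)) c u : pullback J (c *: u) = c *: pullback J u.
Proof. exact: linearZ. Qed.

Lemma pullback0 m n (J : 'M[R]_(m, n)) : pullback J 0 = 0.
Proof. exact: linear0. Qed.

Lemma pullbackB m n (J : 'M[R]_(m, n)) u v : pullback J (u - v) = pullback J u - pullback J v.
Proof. exact: linearB. Qed.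

Lemma pullbackN m n (J : 'M[R]_(m, n)) u : pullback J (- u) = - pullback J u.
Proof. exact: linearN. Qed.

Lemma pullbackD m n (J : 'M[R]_(m, n)) u v : pullback J (u + v) = pullback J u + pullback J v.
Proof. exact: linearD. Qed.

(** Interior product with the i-th coordinate vector. Its sign is the one in [dx_bas], which makes
    it the adjoint of [dx i \wedge _] for [dotx]. *)
Definition contract n (i : 'I_n) (u : ext R n) : ext R n :=
  [ffun S : {set 'I_n} => if i \in S then 0 else wsign R [set i]%SET S * u (i |: S)%SET].

Lemma contract_is_linear n (i : 'I_n) : linear (contract i).
Proof.
move=> c u v; apply/ffunP => S; rewrite !extE [LHS]ffunE ![contract i _ _]ffunE !extE.
by case: ifP => _; rewrite /=; ring.
Qed.
HB.instance Definition _ n (i : 'I_n) :=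
  GRing.isLinear.Build R (ext R n) (ext R n) *:%R (contract i) (contract_is_linear i).

Lemma dx_wedgeE n (i : 'I_n) u S :
  (dx R i \wedge u) S =
  if i \in S then wsign R [set i]%SET (S :\ i)%SET * u (S :\ i)%SET else 0.
Proof. by rewrite dxE bas_wedgeE finset.sub1set; case: ifP => _; rewrite ?mul1r ?mul0r. Qed.

Lemma contract_dx_wedge n (i j : 'I_n) u :
  contract i (dx R j \wedge u) = (i == j)%:R *: u - dx R j \wedge contract i u.
Proof.
apply/ffunP => S; rewrite [LHS]ffunE !extE !dx_wedgeE ![contract _ _ _]ffunE !inE.
have [->|ij] := eqVneq i j.
  rewrite /= mul1r; case: ifP => jS.
    by rewrite finset.setD1K // mulrA wsign_sqr mul1r subrr.
  by rewrite finset.setU1K ?jS // mulrA wsign_sqr mul1r oppr0 addr0.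
rewrite mul0r add0r /=; case: ifP => iS; first by case: ifP => _; rewrite /= ?mulr0 oppr0.
case: ifP => jS; last by rewrite mulr0 oppr0.
have -> : ((i |: S) :\ j = i |: (S :\ j))%SET.
  by apply/finset.setP => k; rewrite !inE; case: eqVneq => // ->; rewrite eq_sym (negPf ij).
have jS' : j \notin (S :\ j)%SET by rewrite !inE eqxx.
have iS' : i \notin (S :\ j)%SET by rewrite !inE iS andbF.
rewrite -{1}(finset.setD1K jS) !wsignUr ?disjoints1 //.
(* The two orders of removing i and inserting j differ by the sign of the transposition of i and j,
   which is -1. *)
have := @wsignC R _ [set i]%SET [set j]%SET; rewrite disjoints1 inE ij !cards1 expr1 => /(_
  isT).
set a := wsign _ _ _ => h; set b := wsign _ _ _ in h *; set c := wsign _ _ _;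
  set d := wsign _ _ _.
by rewrite -[X in - X]mul1r -[in RHS](opprK 1) -h; ring.
Qed.

Lemma contract_covec_wedge n (i : 'I_n) (a : 'rV[R]_n) u :
  contract i (covec a \wedge u) = a 0 i *: u - covec a \wedge contract i u.
Proof.
rewrite covec_sum_dx !wedge_suml linear_sum.
transitivity (\sum_j (a 0 j * (i == j)%:R) *: u - \sum_j a 0 j *: dx R j \wedge contract i u).
  rewrite -sumrB; apply: eq_bigr => j _.
  by rewrite wedgeZl linearZ /= contract_dx_wedge scalerBr scalerA wedgeZl.
congr (_ - _); rewrite -scaler_suml; congr (_ *: _).
by rewrite (bigD1 i) //= eqxx mulr1 big1 ?addr0 // => j /negPf ji; rewrite eq_sym ji mulr0.
Qed.

Lemma contract_ext1 n (i : 'I_n) : contract i (ext1 R n) = 0.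
Proof.
apply/ffunP => S; rewrite !ffunE; case: ifP => // _.
by case: eqP => [/finset.setP/(_ i)|]; rewrite ?mulr0 // !inE eqxx.
Qed.

(** Contracting a pull-back with the i-th coordinate vector is contracting the original form with
    the image of that vector, the i-th column of J. *)
Lemma contract_pullback m n (J : 'M[R]_(m, n)) i u :
  contract i (pullback J u) = pullback J (\sum_j J j i *: contract j u).
Proof.
elim/(@ext_ind R): u => [|k u IH|c u v IHu IHv].
- rewrite pullback_ext1 contract_ext1 big1 ?linear0 // => j _.
  by rewrite contract_ext1 scaler0.
- rewrite pullback_dx_wedge contract_covec_wedge IH mxE !pullback_sum wedge_sumr.
  under [X in _ - X]eq_bigr => j _ do rewrite pullbackZ wedgeZr.
  under [RHS]eq_bigr => j _ do rewrite contract_dx_wedge pullbackZ pullbackB pullbackZ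
    pullback_dx_wedge scalerBr scalerA.
  rewrite sumrB -scaler_suml; congr (_ *: _ - _).
  by rewrite (bigD1 k) //= eqxx mulr1 big1 ?addr0 // => j /negPf jk; rewrite jk mulr0.
- rewrite !linearP /= IHu IHv -linearP /=; congr (pullback _ _).
  rewrite scaler_sumr -big_split; apply: eq_bigr => j _ /=.
  by rewrite linearP /= scalerDr !scalerA mulrC.
Qed.

(** The inner product for which the coordinate monomials of all degrees are orthonormal. *)
Definition dotx n (u v : ext R n) : R := \sum_S u S * v S.

Lemma dotx_is_linear n (v : ext R n) : linear_for *%R (fun u => dotx u v).
Proof.
move=> c a b; rewrite /dotx mulr_sumr -big_split; apply: eq_bigr => S _.
by rewrite !extE /=; ring.
Qed.

Lemma dotxC n (u v : ext R n) : dotx u v = dotx v u.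
Proof. by apply: eq_bigr => S _; rewrite mulrC. Qed.

Lemma dotxDl n (u v w : ext R n) : dotx (u + v) w = dotx u w + dotx v w.
Proof. by have := dotx_is_linear w 1 u v; rewrite scale1r mul1r. Qed.

Lemma dotxZl n c (u w : ext R n) : dotx (c *: u) w = c * dotx u w.
Proof.
by have := dotx_is_linear w c u 0; rewrite addr0 => ->;
  rewrite {2}/dotx big1 ?addr0 // => S _; rewrite ext0 mul0r.
Qed.

Lemma dotx_suml n (J : finType) (F : J -> ext R n) w :
  dotx (\sum_j F j) w = \sum_j dotx (F j) w.
Proof.
elim/big_rec2: _ => [|j y x _ <-]; last by rewrite dotxDl.
by rewrite -[0](scale0r 0) dotxZl mul0r.
Qed.

Lemma dotx_bas n S (v : ext R n) : dotx (bas S) v = v S.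
Proof.
rewrite /dotx (bigD1 S) //= basE eqxx mul1r big1 ?addr0 // => S' /negPf S'S.
by rewrite basE S'S mul0r.
Qed.

Lemma dotx_dx_wedge n i (u v : ext R n) : dotx (dx R i \wedge u) v = dotx u (contract i v).
Proof.
rewrite (ext_basis u) wedge_sumr !dotx_suml; apply: eq_bigr => S _.
rewrite wedgeZr !dotxZl dx_bas dotx_bas ffunE; congr (_ * _).
by case: ifP => _; rewrite ?dotxZl ?dotx_bas // -[0](scale0r 0) dotxZl mul0r.
Qed.

Lemma pullback_set0 m n (J : 'M[R]_(m, n)) u : pullback J u finset.set0 = u finset.set0.
Proof.
elim/(@ext_ind R): u => [|k u IH|c u v IHu IHv].
- by rewrite pullback_ext1 !ffunE !eqxx.
- rewrite pullback_dx_wedge covec_sum_dx wedge_suml ext_sum dx_wedgeE inE big1 // => i _.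
  by rewrite wedgeZl extZ dx_wedgeE inE mulr0.
- by rewrite linearP /= !extE /= IHu IHv.
Qed.

(** In the induction, a left factor [dx k] becomes a contraction on the other side, and
    [contract_pullback] supplies the entries of the transpose. *)
Lemma dotx_pullback m n (J : 'M[R]_(m, n)) u v :
  dotx (pullback J u) v = dotx u (pullback J^T v).
Proof.
elim/(@ext_ind R): u v => [|k u IH|c u w IHu IHw] v.
- by rewrite pullback_ext1 !ext1E !dotx_bas pullback_set0.
- rewrite pullback_dx_wedge covec_sum_dx wedge_suml dotx_suml dotx_dx_wedge contract_pullback.
  rewrite pullback_sum dotxC dotx_suml; apply: eq_bigr => j _.
  by rewrite wedgeZl dotxZl dotx_dx_wedge IH linearZ /= dotxZl dotxC !mxE.
- by rewrite linearP /= !dotxDl !dotxZl IHu IHw.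
Qed.

End Contraction.

(** * The Hodge star and its behaviour under pull-back *)

Section Hodge.
Context {R : realType}.

Lemma wedge_top n (u v : ext R n) :
  (u \wedge v) [set: 'I_n]%SET = \sum_A u A * (wsign R A (~: A)%SET * v (~: A)%SET).
Proof.
rewrite ffunE; apply: eq_big => [A|A _]; first by rewrite inE finset.subsetT.
by rewrite finset.setTD; ring.
Qed.

(** The top-degree pairing is nondegenerate: the monomial on the complement of S reads off the
    coefficient at S, up to sign. *)
Lemma wedge_top_inj n (v w : ext R n) :
  (forall u, (u \wedge v) [set: 'I_n]%SET = (u \wedge w) [set: 'I_n]%SET) -> v = w.
Proof.
move=> vw; apply/ffunP => S; have := vw (bas (~: S)%SET); rewrite !bas_wedgeE finset.subsetT.
rewrite finset.setTD finset.setCK !mul1r => /(congr1 ( *%R (wsign R (~: S)%SET S))).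
by rewrite !mulrA wsign_sqr !mul1r.
Qed.

Lemma wedge_hodge_top n (G : 'M[R]_n) vol u w :
  (u \wedge hodge G vol w) [set: 'I_n]%SET =
  dotx u (pullback (invmx G) w) * vol [set: 'I_n]%SET.
Proof.
rewrite wedge_top /dotx mulr_suml; apply: eq_bigr => A _.
by rewrite ffunE finset.setCK !mulrA -[_ * _ * wsign _ _ _]mulrA wsign_sqr mulr1.
Qed.

Lemma hodge_is_linear n (G : 'M[R]_n) vol : linear (hodge G vol).
Proof.
move=> c u v; apply/ffunP => S; rewrite !extE ![hodge _ _ _ _]ffunE linearP /= !extE.
by ring.
Qed.
HB.instance Definition _ n (G : 'M[R]_n) vol :=
  GRing.isLinear.Build R (ext R n) (ext R n) *:%R (hodge G vol) (hodge_is_linear G vol).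

(** The determinant, defined by the action on top forms; multiplicativity is then functoriality of
    pull-back, and invariance under transposition is adjointness. *)
Definition pdet n (E : 'M[R]_n) : R := pullback E (bas [set: 'I_n]%SET) [set: 'I_n]%SET.

Lemma pullback_top n (E : 'M[R]_n) u :
  pullback E u [set: 'I_n]%SET = pdet E * u [set: 'I_n]%SET.
Proof.
rewrite {1}(ext_basis u) linear_sum ext_sum (bigD1 [set: 'I_n]%SET) //= big1 ?addr0.
  by rewrite linearZ extZ mulrC.
move=> S; rewrite linearZ extZ /=; apply: contraNeq.
rewrite mulf_eq0 negb_or => /andP[_ /(homog_pullback (@homog_bas _ _ S))].
by move=> Sn; rewrite eqEcard finset.subsetT Sn leqnn.
Qed.

Lemma pdetM n (E F : 'M[R]_n) : pdet (E *m F) = pdet E * pdet F.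
Proof. by rewrite /pdet -pullback_comp pullback_top mulrC. Qed.

Lemma pdet_scalar n c : pdet (c%:M : 'M[R]_n) = c ^+ n.
Proof.
rewrite /pdet -scalemx1 (pullback_scale _ _ (@homog_bas _ _ _)) extZ pullback_id basE.
by rewrite eqxx mulr1 cardsT card_ord.
Qed.

Lemma pdet_tr n (E : 'M[R]_n) : pdet E^T = pdet E.
Proof. by rewrite /pdet -!dotx_bas dotxC dotx_pullback trmxK. Qed.

Lemma pdet_neq0 n (E : 'M[R]_n) : E \in unitmx -> pdet E != 0.
Proof.
move=> uE; have : pdet (E *m invmx E) != 0 by rewrite mulmxV // pdet_scalar expr1n oner_eq0.
by rewrite pdetM mulf_eq0 negb_or => /andP[].
Qed.

(* Both sides have the same top-degree pairing with [pullback E u], since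
   [pullback E] is adjoint to [pullback E^T] for [dotx]. *)
Lemma hodge_pullback n (E : 'M[R]_n) vol w : E \in unitmx ->
  hodge (coframe_metric E) (pullback E vol) (pullback E w) =
  pullback E (hodge 1%:M vol w).
Proof.
move=> uE; apply: wedge_top_inj => u; rewrite -(pullbackVK uE u).
rewrite -pullbackM pullback_top !wedge_hodge_top pullback_top dotx_pullback !pullback_comp.
rewrite invmx1 pullback_id /coframe_metric.
have -> : E *m (invmx (E^T *m E) *m E^T) = 1%:M.
  by apply: (can_inj (mulmxK uE)); rewrite -!mulmxA mulVmx ?mulmx1 ?mul1mx // unitmx_mul
    unitmx_tr uE.
by rewrite pullback_id; ring.
Qed.

Definition star0 n : ext R n -> ext R n := hodge 1%:M (bas [set: 'I_n]%SET).
HB.instance Definition _ n := GRing.Linear.on (@star0 n).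

Lemma star0E n (u : ext R n) S : star0 u S = wsign R (~: S)%SET S * u (~: S)%SET.
Proof. by rewrite /star0 ffunE invmx1 pullback_id basE eqxx mulr1. Qed.

Lemma wedge_basE n B (u : ext R n) S :
  (u \wedge bas B) S = (B \subset S)%:R * (wsign R (S :\: B)%SET B * u (S :\: B)%SET).
Proof.
rewrite ffunE; case: (boolP (B \subset S)) => BS.
  have SSB : (S :\: (S :\: B) = B)%SET by rewrite finset.setDDr finset.setDv finset.set0U
    (finset.setIidPr BS).
  rewrite (bigD1 (S :\: B)%SET) ?inE ?finset.subsetDl //= SSB basE eqxx mulr1 mul1r big1
    ?addr0 //.
  move=> A /andP[]; rewrite inE => AS; rewrite basE; apply: contraNeq;
    rewrite mulf_eq0 negb_or => /andP[_].
  by rewrite pnatr_eq0 eqb0 negbK => /eqP<-; rewrite finset.setDDr finset.setDv finset.set0U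
    (finset.setIidPr AS).
rewrite mul0r big1 // => A; rewrite inE => AS; rewrite basE; case: eqP; rewrite ?mulr0 // => AB.
by move: BS; rewrite -AB finset.subsetDl.
Qed.

(** This makes the star computable: a monomial is starred by contracting the volume form with its
    indices, from left to right. *)
Lemma star0_wedge_dx n (i : 'I_n) u : star0 (u \wedge dx R i) = contract i (star0 u).
Proof.
apply/ffunP => S; rewrite [contract _ _ _]ffunE !star0E dxE wedge_basE finset.sub1set inE.
case: ifPn => iS; first by rewrite mul0r mulr0.
rewrite /= mul1r finset.setCU; set C := (~: [set i]%SET :&: ~: S)%SET.
have -> : (~: S :\ i = C)%SET by rewrite finset.setDE finset.setIC.
have CS : (~: S = C :|: [set i])%SET.
  by apply/finset.setP => k; rewrite !inE; case: eqVneq => [->|]; rewrite ?iS ?orbT ?orbF.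
have iC : i \notin C by rewrite !inE eqxx.
rewrite CS wsignUl; last by rewrite disjoint_sym disjoints1.
rewrite wsignUr ?disjoints1 //; ring.
Qed.

Lemma star0_ext1 n : star0 (ext1 R n) = bas [set: 'I_n]%SET.
Proof.
apply/ffunP => S; rewrite star0E [ext1 _ _ _]ffunE basE -finset.setC0 (can2_eq (@finset.setCK
  _) (@finset.setCK _)).
by have [->|] := eqVneq S (~: finset.set0)%SET; rewrite ?mulr0 // finset.setCK wsign0l mulr1.
Qed.

End Hodge.

(** * Evaluation of constant-coefficient forms *)

Section Computation.
Context {R : realType}.
Variable n : nat.
Local Notation N := n.+1.
Implicit Types (s t : seq nat) (F G : seq (seq nat * int)) (i j : nat).

(* The list [:: (s1, c1); ...] stands for c1 dx^s1 + ..., where s1 is a list of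
   0-based indices. *)
Definition mon s : ext R N := \big[@wedge R N/ext1 R N]_(i <- s) dx R (inord i).

Definition den F : ext R N := \sum_(t <- F) t.2%:~R *: mon t.1.

Lemma mon_cons i s : mon (i :: s) = dx R (inord i) \wedge mon s.
Proof. by rewrite /mon big_cons. Qed.

Lemma mon_rcons s i : mon (rcons s i) = mon s \wedge dx R (inord i).
Proof. by rewrite /mon -cats1 big_cat big_seq1. Qed.

Lemma den_cons x F : den (x :: F) = x.2%:~R *: mon x.1 + den F.
Proof. by rewrite /den big_cons. Qed.

Lemma den_nil : den [::] = 0. Proof. by rewrite /den big_nil. Qed.

Lemma den_cat F G : den (F ++ G) = den F + den G.
Proof. by rewrite /den big_cat. Qed.

Lemma homog_mon s : homog (size s) (mon s).
Proof.
elim: s => [|i s IH]; first by rewrite /mon big_nil; exact: homog_ext1.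
rewrite mon_cons; exact: (homog_wedge (@homog_covec _ _ _) IH).
Qed.

Lemma homog_den k F : all (fun x => size x.1 == k) F -> homog k (den F).
Proof.
move=> /allP kF; rewrite /den big_seq; apply: homog_sum => x /kF /eqP <-.
by apply: homogZ; exact: homog_mon.
Qed.

(** The boolean is the parity of the exchanges made, and [None] is the zero form produced by a
    repeated index. *)
Fixpoint mon_insert i s : option (bool * seq nat) :=
  if s is j :: s' then
    if (i < j)%N then Some (false, i :: s)
    else if i == j then None
    else omap (fun x => (~~ x.1, j :: x.2)) (mon_insert i s')
  else Some (false, [:: i]).

Definition oden (x : option (bool * seq nat)) : ext R N :=
  if x is Some y then (-1) ^+ y.1 *: mon y.2 else 0.

Lemma oden_insert i s : oden (mon_insert i s) = dx R (inord i) \wedge mon s.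
Proof.
elim: s => [|j s IH] /=; first by rewrite /oden scale1r mon_cons.
case: ifP => _; first by rewrite /= scale1r mon_cons.
case: eqP => [->|_] /=; first by rewrite mon_cons wedgeA covec_sqr wedge0l.
rewrite mon_cons wedgeA covecC wedgeNl -wedgeA -IH.
case: mon_insert => [[b u]|] /=; last by rewrite wedge0r oppr0.
by rewrite wedgeZr -scaleNr mon_cons; case: b; rewrite /= ?expr0 ?expr1 ?opprK.
Qed.

Definition mon_mul s t : option (bool * seq nat) :=
  foldr (fun i x => obind (fun y => omap (fun z => (y.1 (+) z.1, z.2)) (mon_insert i y.2)) x)
    (Some (false, t)) s.

Lemma oden_mul s t : oden (mon_mul s t) = mon s \wedge mon t.
Proof.
elim: s => [|i s IH] /=; first by rewrite scale1r /mon big_nil wedge1l.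
rewrite mon_cons -wedgeA -IH; case: (mon_mul s t) => [[b u]|] /=; last by rewrite wedge0r.
rewrite wedgeZr -oden_insert; case: mon_insert => [[b' v]|] /=; last by rewrite scaler0.
by rewrite scalerA signr_addb.
Qed.

Fixpoint form_add1 (x : seq nat * int) F :=
  if F is y :: F' then
    if y.1 == x.1 then (y.1, y.2 + x.2) :: F' else y :: form_add1 x F'
  else [:: x].

Lemma den_add1 x F : den (form_add1 x F) = x.2%:~R *: mon x.1 + den F.
Proof.
elim: F => [|y F IH] /=; first by rewrite den_cons.
case: eqP => [yx|_]; rewrite !den_cons /= ?IH; last by rewrite addrCA.
by rewrite yx intrD scalerDl addrA [_ + _ *: mon x.1]addrC.
Qed.

Definition form_add F G := foldr form_add1 G F.

Lemma den_add F G : den (form_add F G) = den F + den G.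
Proof.
elim: F => [|x F IH] /=; first by rewrite den_nil add0r.
by rewrite den_add1 IH den_cons addrA.
Qed.

Definition form_scale (c : int) F := [seq (x.1, c * x.2) | x <- F].

Lemma den_scale c F : den (form_scale c F) = c%:~R *: den F.
Proof.
rewrite /den big_map scaler_sumr; apply: eq_bigr => x _.
by rewrite /= intrM scalerA.
Qed.

Definition form_mon_wedge (x : seq nat * int) G :=
  foldr (fun y H => if mon_mul x.1 y.1 is Some z
                    then form_add1 (z.2, (if z.1 then -1 else 1) * (x.2 * y.2)) H else H) [::]
                      G.

Lemma den_mon_wedge x G : den (form_mon_wedge x G) = (x.2%:~R *: mon x.1) \wedge den G.
Proof.
elim: G => [|y G IH] /=; first by rewrite den_nil wedge0r.
rewrite den_cons wedgeDr -IH wedgeZl wedgeZr -oden_mul.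
case: mon_mul => [[b u]|] /=; last by rewrite !scaler0 add0r.
rewrite den_add1 !scalerA !intrM /=; congr (_ *: _ + _).
by case: b; rewrite /= ?mulN1r ?mul1r ?expr0 ?expr1 ?mulr1 ?mulrN1.
Qed.

Definition form_wedge F G := foldr (fun x H => form_add (form_mon_wedge x G) H) [::] F.

Lemma den_wedge F G : den (form_wedge F G) = den F \wedge den G.
Proof.
elim: F => [|x F IH] /=; first by rewrite den_nil wedge0l.
by rewrite den_add IH den_mon_wedge den_cons wedgeDl.
Qed.

(* [inord] sends the indices that are too large to 0. *)
Definition clip i := if (i < N)%N then i else 0%N.

Lemma val_inord_clip i : (inord i : 'I_N) = clip i :> nat.
Proof. by rewrite /inord val_insubd. Qed.

(** Insertion may compare raw indices, since a missed equality there merely leaves a product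
    unsimplified. Contraction must compare clipped ones: a missed equality would drop a term. *)
Fixpoint mon_contract i s : seq (seq nat * int) :=
  if s is j :: s' then
    (if clip i == clip j then [:: (s', 1)] else [::])
    ++ [seq (j :: x.1, - x.2) | x <- mon_contract i s']
  else [::].

Lemma den_mon_contract i s : den (mon_contract i s) = contract (inord i) (mon s).
Proof.
elim: s => [|j s IH] /=; first by rewrite den_nil /mon big_nil contract_ext1.
rewrite den_cat mon_cons contract_dx_wedge -IH -val_eqE /= !val_inord_clip; congr (_ + _).
  by case: eqP; rewrite ?den_cons den_nil ?addr0 ?scale0r.
rewrite /den big_map wedge_sumr -sumrN; apply: eq_bigr => x _.
by rewrite /= mon_cons wedgeZr intrN scaleNr.
Qed.

Definition form_contract i F :=
  foldr (fun x H => form_add (form_scale x.2 (mon_contract i x.1)) H) [::] F.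

Lemma den_contract i F : den (form_contract i F) = contract (inord i) (den F).
Proof.
elim: F => [|x F IH] /=; first by rewrite den_nil linear0.
by rewrite den_add IH den_scale den_mon_contract den_cons linearD linearZ.
Qed.

Definition form_vol : seq (seq nat * int) := [:: (iota 0 N, 1)].

Lemma bas_mon S : bas S = mon (map val (enum S)).
Proof.
by rewrite -bigw_dx /mon big_map; apply: eq_bigr => i _; rewrite inord_val.
Qed.

Lemma den_vol : den form_vol = bas [set: 'I_N]%SET.
Proof.
rewrite den_cons den_nil addr0 scale1r bas_mon /=; congr mon.
have -> : enum [set: 'I_N]%SET = enum 'I_N by apply: eq_enum => i; rewrite !inE.
by rewrite val_enum_ord.
Qed.

Definition form_star F :=
  foldr (fun x H => form_add (form_scale x.2 (foldl (fun H i => form_contract i H) form_vol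
    x.1)) H)
    [::] F.

Lemma den_star F : den (form_star F) = star0 (den F).
Proof.
elim: F => [|x F IH] /=; first by rewrite den_nil linear0.
rewrite den_add IH den_scale den_cons linearD linearZ /=; congr (_ *: _ + _).
elim/last_ind: x.1 => [|s i IHs] /=; first by rewrite den_vol /mon big_nil star0_ext1.
by rewrite foldl_rcons den_contract IHs mon_rcons star0_wedge_dx.
Qed.

Definition int_mx (g : seq (seq int)) : 'M[R]_N := \matrix_(i, j) ((nth [::] g i)`_j)%:~R.

Definition form_row (g : seq (seq int)) i :=
  [seq ([:: j], (nth [::] g (clip i))`_j) | j <- iota 0 N].

Lemma den_row g i : den (form_row g i) = covec (row (inord i) (int_mx g)).
Proof.
rewrite covec_sum_dx /den big_map -val_enum_ord big_map enumT; apply: eq_bigr => j _.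
by rewrite /= /mon big_seq1 inord_val !mxE val_inord_clip.
Qed.

Definition mon_pull g s := foldr (fun i H => form_wedge (form_row g i) H) [:: ([::], 1)] s.

Lemma den_mon_pull g s : den (mon_pull g s) = pullback (int_mx g) (mon s).
Proof.
elim: s => [|i s IH].
  by rewrite den_cons den_nil addr0 scale1r /mon big_nil pullback_ext1.
have -> : mon_pull g (i :: s) = form_wedge (form_row g i) (mon_pull g s) by [].
by rewrite den_wedge IH den_row mon_cons pullback_dx_wedge.
Qed.

Definition form_pull g F :=
  foldr (fun x H => form_add (form_scale x.2 (mon_pull g x.1)) H) [::] F.

Lemma den_pull g F : den (form_pull g F) = pullback (int_mx g) (den F).
Proof.
elim: F => [|x F IH] /=; first by rewrite den_nil linear0.
by rewrite den_add IH den_scale den_cons linearD linearZ /= den_mon_pull.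
Qed.

(** A syntax for linear operators on forms. The same term is run on lists of integers, read as an
    operator on forms, and later read in an arbitrary coframe, so that one evaluation proves an
    identity in all three senses. *)
Inductive lop :=
  | LId
  | LZero
  | LWedge of lop & seq (seq nat * int)
  | LStar of lop
  | LPull of seq (seq int) & lop
  | LScale of int & lop
  | LAdd of lop & lop.

Fixpoint lop_form (o : lop) F :=
  match o with
  | LId => F
  | LZero => [::]
  | LWedge o G => form_wedge (lop_form o F) G
  | LStar o => form_star (lop_form o F)
  | LPull g o => form_pull g (lop_form o F)
  | LScale c o => form_scale c (lop_form o F)
  | LAdd o o' => form_add (lop_form o F) (lop_form o' F)
  end.

Fixpoint lop_ext (o : lop) (u : ext R N) : ext R N :=
  match o with
  | LId => u
  | LZero => 0
  | LWedge o G => lop_ext o u \wedge den G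
  | LStar o => star0 (lop_ext o u)
  | LPull g o => pullback (int_mx g) (lop_ext o u)
  | LScale c o => c%:~R *: lop_ext o u
  | LAdd o o' => lop_ext o u + lop_ext o' u
  end.

Lemma den_lop o F : den (lop_form o F) = lop_ext o (den F).
Proof.
elim: o => [||o IH G|o IH|g o IH|c o IH|o IH o' IH'] //=.
- exact: den_nil.
- by rewrite den_wedge IH.
- by rewrite den_star IH.
- by rewrite den_pull IH.
- by rewrite den_scale IH.
- by rewrite den_add IH IH'.
Qed.

Lemma lop_is_linear o : linear (lop_ext o).
Proof.
move=> c u v; elim: o => [||o IH G|o IH|g o IH|d o IH|o IH o' IH'] //=.
- by rewrite scaler0 addr0.
- by rewrite IH wedgeDl wedgeZl.
- by rewrite IH linearP.
- by rewrite IH linearP.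
- by rewrite IH scalerDr !scalerA mulrC.
- by rewrite IH IH' scalerDr addrACA.
Qed.
HB.instance Definition _ o := GRing.isLinear.Build R (ext R N) (ext R N) *:%R (lop_ext o)
  (lop_is_linear o).

(** Enumerates the index sets as plain lists, on which [vm_compute] can run. *)
Fixpoint subseqs (T : Type) (s : seq T) : seq (seq T) :=
  if s is x :: s' then let r := subseqs s' in map (cons x) r ++ r else [:: [::]].

Lemma subseqsP (T : eqType) (s t : seq T) : subseq s t -> s \in subseqs t.
Proof.
elim: t s => [|y t IH] [|x s] //=; rewrite mem_cat.
  by rewrite IH ?orbT ?sub0seq.
case: eqP => [->|_] st; last by rewrite IH ?orbT.
by rewrite map_f // IH.
Qed.

(** A sufficient test only, meant for lists in which equal monomials have been merged. *)
Definition form0b F := all (fun x => x.2 == 0) F.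

Lemma form0bP F : form0b F -> den F = 0.
Proof.
move=> /allP F0; rewrite /den big_seq big1 // => x /F0/eqP->.
by rewrite scale0r.
Qed.

Lemma den_eq F G : form0b (form_add F (form_scale (-1) G)) -> den F = den G.
Proof.
by move=> /form0bP; rewrite den_add den_scale mulrN1z scaleN1r => /eqP;
  rewrite subr_eq0 => /eqP.
Qed.

Definition lop_eqb k o o' :=
  all (fun s => form0b (lop_form (LAdd o (LScale (-1) o')) [:: (s, 1)]))
    [seq s <- subseqs (iota 0 N) | size s == k].

Lemma lop_eq k o o' : lop_eqb k o o' -> forall u, homog k u -> lop_ext o u = lop_ext o' u.
Proof.
move=> /allP chk u /homogP ->; rewrite !linear_sum; apply: eq_bigr => S /eqP Sk.
rewrite !linearZ /=; congr (_ *: _).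
have /chk/form0bP : map val (enum S) \in [seq s <- subseqs (iota 0 N) | size s == k].
  rewrite mem_filter size_map -cardE Sk eqxx andTb; apply: subseqsP.
  by rewrite -val_enum_ord; apply: map_subseq; rewrite enumT; apply: filter_subseq.
rewrite den_lop [lop_ext _ _]/= den_cons den_nil addr0 scale1r -bas_mon scaleN1r => /eqP.
by rewrite subr_eq0 => /eqP.
Qed.

End Computation.

(** * Model forms, and operators in an adapted coframe *)

Local Notation form := (seq (seq nat * int)).

Definition omega_form : form := [:: ([:: 0; 1]%N, 1); ([:: 2; 3]%N, 1); ([:: 4; 5]%N, 1)].
Definition psip_form : form :=
  [:: ([:: 0; 2; 4]%N, 1); ([:: 0; 3; 5]%N, -1); ([:: 1; 2; 5]%N, -1); ([:: 1; 3; 4]%N, -1)].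
Definition psim_form : form :=
  [:: ([:: 0; 2; 5]%N, 1); ([:: 0; 3; 4]%N, 1); ([:: 1; 2; 4]%N, 1); ([:: 1; 3; 5]%N, -1)].
Definition phi_form : form :=
  [:: ([:: 0; 1; 6]%N, 1); ([:: 2; 3; 6]%N, 1); ([:: 4; 5; 6]%N, 1)] ++ psip_form.

Section Models.
Context {R : realType}.
Lemma su3_omegaE (E : 'M[R]_6) : su3_omega E = pullback E (den 5 omega_form).
Proof.
rewrite /den !big_cons big_nil /mon !big_cons !big_nil /= !scale1r addr0 !wedge1r.
rewrite !pullbackD !pullbackM !pullback_dx addrA //.
Qed.
Lemma su3_psipE (E : 'M[R]_6) : su3_psip E = pullback E (den 5 psip_form).
Proof.
rewrite /den !big_cons big_nil /mon !big_cons !big_nil /= ?scale1r ?addr0 !wedge1r.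
rewrite !scaleN1r !pullbackD !pullbackN !pullbackM !pullback_dx !wedgeA !addrA //.
Qed.
Lemma su3_psimE (E : 'M[R]_6) : su3_psim E = pullback E (den 5 psim_form).
Proof.
rewrite /den !big_cons big_nil /mon !big_cons !big_nil /= ?scale1r ?addr0 !wedge1r.
rewrite !scaleN1r !pullbackD !pullbackN !pullbackM !pullback_dx !wedgeA !addrA //.
Qed.
Lemma g2_phiE (E : 'M[R]_7) : g2_phi E = pullback E (den 6 phi_form).
Proof.
rewrite /den !big_cons big_nil /mon !big_cons !big_nil /= ?scale1r ?addr0 !wedge1r.
rewrite !scaleN1r !pullbackD !pullbackN !pullbackM !pullback_dx !wedgeA !addrA //.
Qed.

(** The star for which the coframe [E] is orthonormal and positively oriented. *)
Definition frame_star n (E : 'M[R]_n) : ext R n -> ext R n :=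
  hodge (coframe_metric E) (pullback E (bas [set: 'I_n]%SET)).
HB.instance Definition _ n (E : 'M[R]_n) := GRing.Linear.on (frame_star E).

Lemma hodge_top n (G : 'M[R]_n) (v v' u : ext R n) :
  v [set: 'I_n]%SET = v' [set: 'I_n]%SET -> hodge G v u = hodge G v' u.
Proof. by move=> vv; apply/ffunP => S; rewrite !ffunE vv. Qed.

Lemma frame_starE n (E : 'M[R]_n) u : E \in unitmx ->
  frame_star E (pullback E u) = pullback E (star0 u).
Proof. exact: hodge_pullback. Qed.

Section FrameOps.
Variables (n : nat) (E : 'M[R]_n.+1).
Hypothesis uE : E \in unitmx.

(** The conjugate of [lop_ext l] by pull-back along [E]. A matrix is conjugated as well, which is
    how the standard complex structure becomes [su3_J]. *)
Fixpoint lop_frame (l : lop) (u : ext R n.+1) : ext R n.+1 :=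
  match l with
  | LId => u
  | LZero => 0
  | LWedge l G => lop_frame l u \wedge pullback E (den n G)
  | LStar l => frame_star E (lop_frame l u)
  | LPull g l => pullback (invmx E *m int_mx n g *m E) (lop_frame l u)
  | LScale c l => c%:~R *: lop_frame l u
  | LAdd l l' => lop_frame l u + lop_frame l' u
  end.

Lemma lop_frame_pullback l u : lop_frame l (pullback E u) = pullback E (lop_ext l u).
Proof.
elim: l => [||l IH G|l IH|g l IH|c l IH|l IH l' IH'] /=.
- by [].
- by rewrite linear0.
- by rewrite IH pullbackM.
- by rewrite IH frame_starE.
- by rewrite IH !pullback_comp !mulmxA mulmxV // mul1mx.
- by rewrite IH pullbackZ.
- by rewrite IH IH' pullbackD.
Qed.

Lemma lop_frame_eq k l l' : lop_eqb n k l l' ->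
  forall u, homog k u -> lop_frame l u = lop_frame l' u.
Proof.
move=> chk u hu; rewrite -(pullbackVK uE u) !lop_frame_pullback.
by rewrite (lop_eq chk) //; apply: homog_pullback.
Qed.

End FrameOps.
End Models.

(** * SU(3)-structures *)

Section SU3Identities.
Context {R : realType}.
Variables o p m : ext R 6.
Hypothesis adapted : exists E, su3_adapted o p m E.
Let E := su3_coframe o p m.
Local Notation star := (su3_star o p m).

Lemma su3_coframeP : su3_adapted o p m (su3_coframe o p m).
Proof. by rewrite /su3_coframe; case: xgetP => [_ -> //|];
  case: adapted => F /[swap] /(_ F). Qed.

Let uE : E \in unitmx. Proof. by case: su3_coframeP. Qed.
Let oE : o = pullback E (den 5 omega_form).
Proof. by case: su3_coframeP => *; rewrite -su3_omegaE. Qed.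
Let pE : p = pullback E (den 5 psip_form).
Proof. by case: su3_coframeP => *; rewrite -su3_psipE. Qed.
Let mE : m = pullback E (den 5 psim_form).
Proof. by case: su3_coframeP => *; rewrite -su3_psimE. Qed.

Lemma su3_starE w : star w = frame_star E w.
Proof.
rewrite /su3_star /frame_star -/E; congr (hodge _ _ _).
rewrite {1 2 3}oE -!pullbackM -!den_wedge -pullbackZ -den_vol; congr (pullback _ _).
(* omega^3 is six times e^123456, which the factor 1/6 in [su3_star] compensates. *)
rewrite (_ : form_wedge _ _ = form_scale 6 (form_vol 5)); last by vm_compute.
by rewrite den_scale scalerA mulVf ?scale1r // intr_eq0.
Qed.

Lemma su3_ops k l l' : lop_eqb 5 k l l' ->
  forall u, homog k u -> lop_frame E l u = lop_frame E l' u.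
Proof. exact: lop_frame_eq. Qed.

Definition J0_form : seq (seq int) := mkseq (fun i => mkseq (fun j =>
  if ~~ odd j && (i == j.+1) then 1 else if odd j && (j == i.+1) then -1 else 0) 6) 6.

Lemma su3_JE : su3_J o p m = invmx E *m int_mx 5 J0_form *m E.
Proof.
rewrite /su3_J -/E; congr (_ *m _ *m _); apply/matrixP => i j; rewrite !mxE.
rewrite nth_mkseq // nth_mkseq //.
by case: ifP => //; case: ifP.
Qed.

Definition omega2_form := form_wedge omega_form omega_form.

Let o2E : o \wedge o = pullback E (den 5 omega2_form).
Proof. by rewrite den_wedge pullbackM -oE. Qed.


(** Evaluates the identity on standard monomials of degree k, moves it to the coframe [E], and folds
    the pulled-back models into [o], [p], [m] and the star. *)
Local Ltac su3_identity k l l' hu :=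
  have: lop_eqb 5 k l l' by [vm_compute];
  move=> /su3_ops /(_ _ hu);
  rewrite /= -?o2E -?oE -?pE -?mE -?su3_starE ?mulrN1z ?scaleN1r.

Lemma su3_star_psip_psip g : homog 1 g -> star (g \wedge p) \wedge p = 2 *: star g.
Proof.
by move=> hg; su3_identity 1%N (LWedge (LStar (LWedge LId psip_form)) psip_form) (LScale 2
  (LStar LId)) hg.
Qed.

Lemma su3_star_psim_psim g : homog 1 g -> star (g \wedge m) \wedge m = 2 *: star g.
Proof.
by move=> hg; su3_identity 1%N (LWedge (LStar (LWedge LId psim_form)) psim_form) (LScale 2
  (LStar LId)) hg.
Qed.

Lemma su3_star_psip_psim g : homog 1 g -> star (g \wedge p) \wedge m = - (g \wedge (o \wedge
  o)).
Proof.
by move=> hg; su3_identity 1%N (LWedge (LStar (LWedge LId psip_form)) psim_form) (LScale (-1)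
  (LWedge LId omega2_form)) hg.
Qed.

Lemma su3_star_psim_psip g : homog 1 g -> star (g \wedge m) \wedge p = g \wedge (o \wedge o).
Proof.
by move=> hg; su3_identity 1%N (LWedge (LStar (LWedge LId psim_form)) psip_form) (LWedge LId
  omega2_form) hg.
Qed.

Lemma su3_star_omega2_psip g : homog 1 g -> star (g \wedge (o \wedge o)) \wedge p = - (2 *: (g
  \wedge m)).
Proof.
by move=> hg; su3_identity 1%N (LWedge (LStar (LWedge LId omega2_form)) psip_form) (LScale
  (-1) (LScale 2 (LWedge LId psim_form))) hg.
Qed.

Lemma su3_star_omega2_psim g : homog 1 g -> star (g \wedge (o \wedge o)) \wedge m = 2 *: (g
  \wedge p).
Proof.
by move=> hg; su3_identity 1%N (LWedge (LStar (LWedge LId omega2_form)) psim_form) (LScale 2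
  (LWedge LId psip_form)) hg.
Qed.

Lemma su3_star_psip_omega g : homog 1 g -> star (g \wedge p) \wedge o = g \wedge p.
Proof.
by move=> hg; su3_identity 1%N (LWedge (LStar (LWedge LId psip_form)) omega_form) (LWedge LId
  psip_form) hg.
Qed.

Lemma su3_star_psim_omega g : homog 1 g -> star (g \wedge m) \wedge o = g \wedge m.
Proof.
by move=> hg; su3_identity 1%N (LWedge (LStar (LWedge LId psim_form)) omega_form) (LWedge LId
  psim_form) hg.
Qed.

Lemma su3_star_psip_omega2 g : homog 1 g -> star (g \wedge p) \wedge (o \wedge o) = 0.
Proof.
by move=> hg; su3_identity 1%N (LWedge (LStar (LWedge LId psip_form)) omega2_form) LZero hg.
Qed.

Lemma su3_star_psim_omega2 g : homog 1 g -> star (g \wedge m) \wedge (o \wedge o) = 0.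
Proof.
by move=> hg; su3_identity 1%N (LWedge (LStar (LWedge LId psim_form)) omega2_form) LZero hg.
Qed.

Lemma su3_star_omega_psip g : homog 1 g -> star (g \wedge o) \wedge p = 0.
Proof.
by move=> hg; su3_identity 1%N (LWedge (LStar (LWedge LId omega_form)) psip_form) LZero hg.
Qed.

Lemma su3_star_omega_psim g : homog 1 g -> star (g \wedge o) \wedge m = 0.
Proof.
by move=> hg; su3_identity 1%N (LWedge (LStar (LWedge LId omega_form)) psim_form) LZero hg.
Qed.

Lemma su3_star_omega2_omega2 g : homog 1 g -> star (g \wedge (o \wedge o)) \wedge (o \wedge o)
  = 4 *: star g.
Proof.
by move=> hg; su3_identity 1%N (LWedge (LStar (LWedge LId omega2_form)) omega2_form) (LScale 4
  (LStar LId)) hg.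
Qed.

Lemma su3_star_omega_omega g : homog 1 g -> star (g \wedge o) \wedge o = 2 *: star g.
Proof.
by move=> hg; su3_identity 1%N (LWedge (LStar (LWedge LId omega_form)) omega_form) (LScale 2
  (LStar LId)) hg.
Qed.

Lemma su3_starK3 g : homog 3 g -> star (star g) = - g.
Proof.
by move=> hg; su3_identity 3%N (LStar (LStar LId)) (LScale (-1) LId) hg.
Qed.

Lemma su3_starK4 g : homog 4 g -> star (star g) = g.
Proof.
by move=> hg; su3_identity 4%N (LStar (LStar LId)) LId hg.
Qed.

(** With the next two lemmas, this carries the conditions defining Omega^3_12 from nu_3 to its
    star. *)
Lemma su3_star3_psip g : homog 3 g -> star g \wedge p = - (g \wedge m).
Proof.
by move=> hg; su3_identity 3%N (LWedge (LStar LId) psip_form) (LScale (-1) (LWedge LId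
  psim_form)) hg.
Qed.

Lemma su3_star3_psim g : homog 3 g -> star g \wedge m = g \wedge p.
Proof.
by move=> hg; su3_identity 3%N (LWedge (LStar LId) psim_form) (LWedge LId psip_form) hg.
Qed.

Lemma su3_star3_omega g : homog 3 g -> 2 *: (star g \wedge o) = star (g \wedge o) \wedge (o
  \wedge o).
Proof.
by move=> hg; su3_identity 3%N (LScale 2 (LWedge (LStar LId) omega_form)) (LWedge (LStar
  (LWedge LId omega_form)) omega2_form) hg.
Qed.

Lemma su3_type28_star b : homog 2 b -> su3_type28 o p m b -> star b = - (b \wedge o).
Proof.
move=> hb [Jb bo].
(* Valid for every 2-form: 4 (star b + b /\ omega) is 4 (b - J b) /\ omega plus star (b /\ omega^2)
   /\ omega^2, and both terms vanish on Omega^2_8. *)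
have chk : lop_eqb 5 2 (LScale 4 (LAdd (LStar LId) (LWedge LId omega_form)))
  (LAdd (LScale 4 (LWedge (LAdd LId (LScale (-1) (LPull J0_form LId))) omega_form))
        (LWedge (LStar (LWedge LId omega2_form)) omega2_form)) by vm_compute.
have := su3_ops chk hb; rewrite /= -!o2E -!oE -!su3_starE -su3_JE Jb bo mulrN1z scaleN1r subrr.
rewrite wedge0l scaler0 add0r [star 0]linear0 wedge0l => /eqP.
by rewrite scaler_eq0 intr_eq0 /= addr_eq0 => /eqP.
Qed.

Lemma su3_type28_psip b : homog 2 b -> su3_type28 o p m b -> b \wedge p = 0.
Proof.
move=> hb [Jb bo].
(* By type, only the (2,0) and (0,2) parts of b survive the product with psi_+. There J is -1, so b
   - J b is twice that part. *)
have chk : lop_eqb 5 2 (LScale 2 (LWedge LId psip_form))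
  (LWedge (LAdd LId (LScale (-1) (LPull J0_form LId))) psip_form) by vm_compute.
have := su3_ops chk hb; rewrite /= -!pE -su3_JE Jb mulrN1z scaleN1r subrr wedge0l => /eqP.
by rewrite scaler_eq0 intr_eq0 /= => /eqP.
Qed.

Lemma su3_type28_psim b : homog 2 b -> su3_type28 o p m b -> b \wedge m = 0.
Proof.
move=> hb [Jb bo].
have chk : lop_eqb 5 2 (LScale 2 (LWedge LId psim_form))
  (LWedge (LAdd LId (LScale (-1) (LPull J0_form LId))) psim_form) by vm_compute.
have := su3_ops chk hb; rewrite /= -!mE -su3_JE Jb mulrN1z scaleN1r subrr wedge0l => /eqP.
by rewrite scaler_eq0 intr_eq0 /= => /eqP.
Qed.


(** An identity between fixed forms is an operator identity of degree 0 applied to the constant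
    1. *)
Lemma su3_omega_psip : o \wedge p = 0.
Proof.
by su3_identity 0%N (LWedge (LWedge LId omega_form) psip_form) LZero (@homog_ext1 R 6);
  rewrite ?wedge1l.
Qed.

Lemma su3_omega_psim : o \wedge m = 0.
Proof.
by su3_identity 0%N (LWedge (LWedge LId omega_form) psim_form) LZero (@homog_ext1 R 6);
  rewrite ?wedge1l.
Qed.

Lemma su3_psip_psip : p \wedge p = 0.
Proof.
by su3_identity 0%N (LWedge (LWedge LId psip_form) psip_form) LZero (@homog_ext1 R 6);
  rewrite ?wedge1l.
Qed.

Lemma su3_psim_psim : m \wedge m = 0.
Proof.
by su3_identity 0%N (LWedge (LWedge LId psim_form) psim_form) LZero (@homog_ext1 R 6);
  rewrite ?wedge1l.
Qed.

Lemma su3_psim_psip : m \wedge p = - (p \wedge m).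
Proof.
by su3_identity 0%N (LWedge (LWedge LId psim_form) psip_form) (LScale (-1) (LWedge (LWedge LId
  psip_form) psim_form)) (@homog_ext1 R 6); rewrite ?wedge1l.
Qed.

Lemma su3_omega3 : 2 *: (o \wedge (o \wedge o)) = 3 *: (p \wedge m).
Proof.
by su3_identity 0%N (LScale 2 (LWedge (LWedge LId omega_form) omega2_form)) (LScale 3 (LWedge
  (LWedge LId psip_form) psim_form)) (@homog_ext1 R 6); rewrite ?wedge1l.
Qed.

Lemma su3_star_omega : 2 *: star o = o \wedge o.
Proof.
by su3_identity 0%N (LScale 2 (LStar (LWedge LId omega_form))) (LWedge LId omega2_form)
  (@homog_ext1 R 6); rewrite ?wedge1l.
Qed.

Lemma su3_star_psip : star p = m.
Proof.
by su3_identity 0%N (LStar (LWedge LId psip_form)) (LWedge LId psim_form) (@homog_ext1 R 6);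
  rewrite ?wedge1l.
Qed.

Lemma su3_star_psim : star m = - p.
Proof.
by su3_identity 0%N (LStar (LWedge LId psim_form)) (LScale (-1) (LWedge LId psip_form))
  (@homog_ext1 R 6); rewrite ?wedge1l.
Qed.

End SU3Identities.

(** * G_2-structures *)

Section G2.
Context {R : realType}.

Local Notation phi0 := (den 6 phi_form : ext R 7).
Local Notation vol0 := (bas [set: 'I_7]%SET : ext R 7).

Lemma phi0_metric (i j : 'I_7) :
  contract i phi0 \wedge contract j phi0 \wedge phi0 = (6 *+ (i == j)) *: vol0.
Proof.
pose F (a b : nat) := form_add
  (form_wedge (form_wedge (form_contract 6 a phi_form) (form_contract 6 b phi_form)) phi_form)
  (form_scale (if a == b then - 6%:Z else 0) (form_vol 6)).
have /allP chk : all (fun a => all (fun b => form0b (F a b)) (iota 0 7)) (iota 0 7) by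
  vm_compute.
have im (k : 'I_7) : (k : nat) \in iota 0 7 by rewrite mem_iota /=.
have /allP/(_ _ (im j))/form0bP-/(_ R 6) := chk _ (im i).
rewrite den_add !den_wedge !den_contract !inord_val den_scale den_vol => /eqP.
rewrite addr_eq0 -scaleNr => /eqP ->; congr (_ *: _); rewrite -val_eqE.
by case: eqP; rewrite ?intrN ?opprK ?oppr0.
Qed.

Lemma g2_stabilizer (A : 'M[R]_7) : pullback A phi0 = phi0 -> A^T *m A = 1%:M /\ pdet A = 1.
Proof.
move=> Aphi.
have Agram : pdet A *: (A^T *m A) = 1%:M.
  (* Substituting A^* phi0 for phi0 in the metric identity produces the entry of A^T A at (k, l)
     from the two contractions and [pdet A] from the top form. *)
  apply/matrixP => k l; have := phi0_metric k l; rewrite -Aphi !contract_pullback -!pullbackM.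
  rewrite wedge_suml wedge_suml => /(congr1 (fun u : ext R 7 => u [set: 'I_7]%SET)).
  rewrite pullback_top ext_sum !extZ basE eqxx mulr1 => h.
  apply: (@mulfI _ 6); first by rewrite pnatr_eq0.
  rewrite !mxE [RHS]mulr_natr -h mulrCA; congr (_ * _).
  rewrite mulr_sumr; apply: eq_bigr => i _.
  rewrite !wedgeZl [contract i _ \wedge _]wedge_sumr wedge_suml !(extZ, ext_sum) (bigD1 i) //=
    big1 ?addr0.
    rewrite wedgeZr wedgeZl phi0_metric !extZ basE !eqxx /= mxE; ring.
  by move=> j /negPf ji; rewrite wedgeZr wedgeZl phi0_metric eq_sym ji scale0r scaler0 ext0.
(* The determinant of the Gram relation in dimension 7 is pdet^7 * pdet^2 = 1. The exponent 9 is
   odd, which settles the sign and then the value. *)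
have A1 : pdet A = 1.
  have : pdet A ^+ 9 = 1.
    rewrite -[RHS](expr1n R 7) -(@pdet_scalar R 7 1) -Agram -mul_scalar_mx !pdetM pdet_tr
      pdet_scalar.
    by ring.
  move=> h; have p0 : 0 <= pdet A.
    by rewrite -(@exprn_odd_ge0 _ 9) // h ler01.
  by apply/eqP; rewrite -(@pexpr_eq1 _ _ 9) // h.
by split=> //; rewrite -Agram A1 scale1r.
Qed.

Lemma g2_adapted_unique (phi : ext R 7) E F : g2_adapted phi E -> g2_adapted phi F ->
  coframe_metric E = coframe_metric F /\ pdet E = pdet F.
Proof.
move=> [uE phiE] [uF phiF].
have [] := @g2_stabilizer (F *m invmx E).
  by rewrite -pullback_comp -g2_phiE -phiF phiE g2_phiE pullbackK.
set A := F *m invmx E => AA dA.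
have FE : F = A *m E by rewrite /A -mulmxA mulVmx // mulmx1.
split; last by rewrite FE pdetM dA mul1r.
by rewrite FE /coframe_metric trmx_mul mulmxA -(mulmxA E^T) AA mulmx1.
Qed.

Lemma g2_coframeP (phi : ext R 7) : (exists E, g2_adapted phi E) -> g2_adapted phi (g2_coframe
  phi).
Proof. by move=> [E]; rewrite /g2_coframe; case: xgetP => [_ -> //|/[swap] + /(_ E)]. Qed.

(** Replaces the arbitrarily chosen coframe by any convenient one; two adapted coframes differ by a
    stabilizer of the model form. *)
Lemma g2_starE (phi : ext R 7) E u : g2_adapted phi E -> g2_star phi u = frame_star E u.
Proof.
move=> aE; have aF := g2_coframeP (ex_intro _ E aE).
have [gE dE] := g2_adapted_unique aF aE.
rewrite /g2_star /frame_star gE; apply: hodge_top.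
rewrite pullback_top basE eqxx mulr1 -dE.
transitivity (pullback (g2_coframe phi) (den 6 (form_vol 6)) [set: 'I_7]%SET); last first.
  by rewrite pullback_top den_vol basE eqxx mulr1.
rewrite den_cons den_nil addr0 scale1r /mon !big_cons big_nil wedge1r.
by rewrite !pullbackM !pullback_dx !wedgeA.
Qed.

Definition star_phi_form := form_star 6 phi_form.

(** * Uniqueness of the torsion forms of a G_2-structure *)

Section Torsion.
Variables (phi : ext R 7) (E : 'M[R]_7).
Hypothesis aE : g2_adapted phi E.
Let uE : E \in unitmx. Proof. by case: aE. Qed.
Let phiE : phi = pullback E phi0. Proof. by case: aE => _ {1}->; rewrite g2_phiE. Qed.
Local Notation star := (g2_star phi).
Let starE u : frame_star E u = star u. Proof. by rewrite -(g2_starE u aE). Qed.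
Let sphiE : pullback E (den 6 star_phi_form) = star phi.
Proof. by rewrite den_star -frame_starE // starE -phiE. Qed.

Lemma g2_star_omega14 b : homog 2 b -> g2_type214 phi b -> star (b \wedge phi) = - b.
Proof.
move=> hb b14.
(* The right-hand operator factors through b /\ star phi, hence vanishes on Omega^2_14, while the
   identity itself holds for every 2-form. *)
have chk : lop_eqb 6 2 (LAdd (LStar (LWedge LId phi_form)) LId)
   (LStar (LWedge (LStar (LWedge LId star_phi_form)) star_phi_form)) by vm_compute.
have := lop_frame_eq uE chk hb; rewrite /= -phiE sphiE !starE b14 => /eqP.
have s0 : star 0 = 0 by rewrite -starE linear0.
by rewrite s0 wedge0l s0 addr_eq0 => /eqP.
Qed.

Lemma g2_star_star_phi g : homog 1 g ->
  star (g \wedge star phi) \wedge star phi = 3 *: star g.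
Proof.
move=> hg.
have chk : lop_eqb 6 1 (LWedge (LStar (LWedge LId star_phi_form)) star_phi_form) (LScale 3
  (LStar LId))
  by vm_compute.
by have := lop_frame_eq uE chk hg; rewrite /= sphiE !starE.
Qed.

Let starZ c u : star (c *: u) = c *: star u. Proof. by rewrite -!starE linearZ. Qed.
Let star_0 : star 0 = 0. Proof. by rewrite -starE linear0. Qed.
Let starD u v : star (u + v) = star u + star v. Proof. by rewrite -!starE linearD. Qed.

Let starK1 g : homog 1 g -> star (star g) = g.
Proof.
have chk : lop_eqb 6 1 (LStar (LStar LId)) LId by vm_compute.
by move=> hg; have := lop_frame_eq uE chk hg; rewrite /= !starE.
Qed.

Let starK3 g : homog 3 g -> star (star g) = g.
Proof.
have chk : lop_eqb 6 3 (LStar (LStar LId)) LId by vm_compute.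
by move=> hg; have := lop_frame_eq uE chk hg; rewrite /= !starE.
Qed.

Let phi_wedge_star : phi \wedge star phi != 0.
Proof.
have chk : lop_eqb 6 0 (LWedge (LWedge LId phi_form) star_phi_form) (LScale 7 (LWedge LId
  (form_vol 6)))
  by vm_compute.
have := lop_frame_eq uE chk (@homog_ext1 R 7); rewrite /= -phiE sphiE !wedge1l => ->.
apply/eqP => /(congr1 (fun u : ext R 7 => u [set: 'I_7]%SET)).
rewrite extZ pullback_top den_vol basE eqxx mulr1 ext0 => /eqP.
by rewrite mulf_eq0 intr_eq0 (negPf (pdet_neq0 uE)).
Qed.

Let homog_phi : homog 3 phi.
Proof.
by rewrite phiE; apply: homog_pullback; apply: homog_den.
Qed.

(* On [Omega^2_14] one has [star (b /\ phi) = - b]; the second equation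
   therefore gives [t2 = 4 star (t1 /\ star phi)], and wedging with [star phi]
   isolates [t1]. *)
Lemma g2_torsion_zero c t1 t2 t3 :
  homog 1 t1 -> homog 2 t2 -> homog 3 t3 -> g2_type214 phi t2 -> g2_type327 phi t3 ->
  c *: star phi + 3 *: (t1 \wedge phi) + star t3 = 0 ->
  4 *: (t1 \wedge star phi) + t2 \wedge phi = 0 ->
  [/\ c = 0, t1 = 0, t2 = 0 & t3 = 0].
Proof.
move=> h1 h2 h3 t2P [_ t3P] eq4 eq5.
have t2E : t2 = 4 *: star (t1 \wedge star phi).
  rewrite -[t2]opprK -(g2_star_omega14 h2 t2P) -starZ.
  by move/eqP: eq5; rewrite addrC addr_eq0 -scaleNr => /eqP ->; rewrite !starZ -scaleNr opprK.
have t10 : t1 = 0.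
  rewrite -(starK1 h1); move: t2P; rewrite /g2_type214 t2E wedgeZl g2_star_star_phi // scalerA
    => /eqP.
  by rewrite scaler_eq0 mulf_eq0 !pnatr_eq0 /= => /eqP ->.
have t20 : t2 = 0 by rewrite t2E t10 wedge0l star_0 scaler0.
(* The star is an involution on 3-forms, so once t1 = 0 the first equation says t3 + c phi = 0.
   Since t3 /\ star phi = 0 and phi /\ star phi is seven times the volume form, c vanishes. *)
have t3E : t3 = - (c *: phi).
  apply/eqP; rewrite -addr_eq0 -(starK3 h3).
  have -> : c *: phi = star (c *: star phi) by rewrite starZ starK3.
  rewrite -starD addrC.
  by move: eq4; rewrite t10 wedge0l scaler0 addr0 => ->; rewrite star_0.
have c0 : c = 0.
  apply/eqP; move: t3P; rewrite t3E wedgeNl wedgeZl => /eqP.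
  by rewrite oppr_eq0 scaler_eq0 (negPf phi_wedge_star) orbF.
by split=> //; rewrite t3E c0 scale0r oppr0.
Qed.

Lemma g2_torsion_unique X Y a1 a2 a3 b1 b2 b3 (a0 b0 : R) :
  homog 1 a1 -> homog 2 a2 -> homog 3 a3 -> g2_type214 phi a2 -> g2_type327 phi a3 ->
  X = a0 *: star phi + 3 *: (a1 \wedge phi) + star a3 ->
  Y = 4 *: (a1 \wedge star phi) + a2 \wedge phi ->
  homog 1 b1 -> homog 2 b2 -> homog 3 b3 -> g2_type214 phi b2 -> g2_type327 phi b3 ->
  X = b0 *: star phi + 3 *: (b1 \wedge phi) + star b3 ->
  Y = 4 *: (b1 \wedge star phi) + b2 \wedge phi ->
  [/\ a0 = b0, a1 = b1, a2 = b2 & a3 = b3].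
Proof.
move=> ha1 ha2 ha3 Ta2 [Ta3 Ta3'] Xa Ya hb1 hb2 hb3 Tb2 [Tb3 Tb3'] Xb Yb.
have [||||||| /subr0_eq -> /subr0_eq -> /subr0_eq -> /subr0_eq -> //] :=
  @g2_torsion_zero (a0 - b0) (a1 - b1) (a2 - b2) (a3 - b3).
- exact: homogB.
- exact: homogB.
- exact: homogB.
- by move: Ta2 Tb2; rewrite /g2_type214 wedgeBl => -> ->; rewrite subrr.
- by rewrite /g2_type327 !wedgeBl Ta3 Tb3 Ta3' Tb3' !subrr.
- have -> : star (a3 - b3) = star a3 - star b3 by rewrite -!starE linearB.
  rewrite wedgeBl scalerBr scalerBl.
  rewrite -(subrr X) {1}Xa Xb; set x := _ *: star phi; set y := _ *: star phi.
  set z := 3 *: _; set t := 3 *: _; set v := star _; set w := star _.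
  by apply/ffunP => S; rewrite !extE; ring.
- rewrite !wedgeBl scalerBr -(subrr Y) {1}Ya Yb; set x := 4 *: _; set y := 4 *: _.
  set z := a2 \wedge _; set t := b2 \wedge _.
  by apply/ffunP => S; rewrite !extE; ring.
Qed.

End Torsion.
End G2.

(** * Forms on a cylinder *)

Section CylinderForms.
Context {R : realType} {n : nat}.
Local Notation max := (@ord_max n.+1).
Local Notation B := (@from_base R n).
Local Notation dt := (@Defs.dt R n).
Implicit Types (A C S : {set 'I_n.+1}) (D : {set 'I_n.+2}) (u v : ext R n.+1).

Definition base_mx : 'M[R]_(n.+1, n.+2) := \matrix_(k, j) (j == lift max k)%:R.

Lemma from_baseE u : B u = pullback base_mx u. Proof. by []. Qed.


Lemma from_baseD u v : B (u + v) = B u + B v. Proof. exact: pullbackD. Qed.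
Lemma from_baseZ c u : B (c *: u) = c *: B u. Proof. exact: pullbackZ. Qed.
Lemma from_baseN u : B (- u) = - B u. Proof. exact: pullbackN. Qed.
Lemma from_base0 : B 0 = 0. Proof. exact: pullback0. Qed.
Lemma from_baseM u v : B (u \wedge v) = B u \wedge B v. Proof. exact: pullbackM. Qed.
Lemma homog_from_base k u : homog k u -> homog k (B u). Proof. exact: homog_pullback. Qed.
Lemma homog_dt : homog 1 dt. Proof. exact: homog_covec. Qed.

Lemma row_base_mx k : row k base_mx = delta_mx 0 (lift max k).
Proof. by apply/rowP => j; rewrite !mxE eqxx. Qed.

Lemma from_base_dx k : B (dx R k) = dx R (lift max k).
Proof. by rewrite from_baseE pullback_dx row_base_mx. Qed.

Lemma wsign_lift A C : wsign R (lift max @: A)%SET (lift max @: C)%SET = wsign R A C.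
Proof.
rewrite !wsignE big_imset; last by move=> i j _ _; apply: lift_inj.
apply: eq_bigr => i _; rewrite big_imset; last by move=> j k _ _; apply: lift_inj.
by apply: eq_bigr => j _; rewrite !lift_max.
Qed.

(** No index exceeds that of t, so a factor dt on the right costs no sign; forms on the cylinder are
    therefore split as B u + B v /\ dt. *)
Lemma wsign_max (D : {set 'I_n.+2}) : wsign R D [set max]%SET = 1.
Proof.
rewrite wsignE big1 // => i _; rewrite big_set1.
by rewrite [(_ < i)%N]leqNgt ltn_ord.
Qed.

Lemma wsign_max_lift A : wsign R [set max]%SET (lift max @: A)%SET = (-1) ^+ #|A|.
Proof.
rewrite wsignE big_set1 big_imset; last by move=> i j _ _; apply: lift_inj.
by rewrite -prodr_const; apply: eq_bigr => i _; rewrite lift_max ltn_ord.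
Qed.

Lemma max_notin_lift A : max \notin (lift max @: A)%SET.
Proof. by apply/imsetP => -[i _ /eqP]; rewrite (negPf (neq_lift _ _)). Qed.

Lemma from_base_bas S : B (bas S) = bas (lift max @: S)%SET.
Proof.
elim/set_ind_add: S => [|i S iS IH].
  by rewrite imset0 -!ext1E from_baseE pullback_ext1.
have basU : bas (i |: S)%SET = wsign R [set i]%SET S *: (dx R i \wedge bas S).
  by rewrite dx_bas (negPf iS) scalerA wsign_sqr scale1r.
rewrite basU from_baseZ from_baseM from_base_dx IH dx_bas mem_imset; last exact: lift_inj.
by rewrite (negPf iS) imsetU1 -(wsign_lift [set i]%SET) imset_set1 scalerA wsign_sqr scale1r.
Qed.

Definition res D : {set 'I_n.+1} := (lift max @^-1: D)%SET.

Lemma res_lift S : res (lift max @: S)%SET = S.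
Proof. by apply/finset.setP => i; rewrite inE mem_imset //; apply: lift_inj. Qed.

Lemma lift_res D : (lift max @: res D = D :\ max)%SET.
Proof.
apply/finset.setP => j; rewrite !inE; apply/imsetP/andP => [[i iS ->]|[jm jS]].
  by rewrite inE in iS; rewrite eq_sym neq_lift.
by case: (unliftP max j) jm jS => [i ->|->]; rewrite ?eqxx // => _ iS; exists i; rewrite ?inE.
Qed.

Lemma resC D : res (~: D)%SET = (~: res D)%SET.
Proof. by apply/finset.setP => i; rewrite !inE. Qed.

Lemma resD1 D : res (D :\ max)%SET = res D.
Proof. by apply/finset.setP => i; rewrite !inE eq_sym neq_lift. Qed.

Lemma from_base_coef u D : B u D = if max \in D then 0 else u (res D).
Proof.
rewrite (ext_basis u) from_baseE pullback_sum !ext_sum; case: ifPn => mS.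
  apply: big1 => S _; rewrite pullbackZ -from_baseE from_base_bas extZ basE.
  by case: eqP mS => [->|_ _]; rewrite ?mulr0 // (negPf (max_notin_lift S)).
apply: eq_bigr => S _; rewrite pullbackZ -from_baseE from_base_bas !extZ !basE.
congr (_ * _%:R); congr nat_of_bool; apply/eqP/eqP => [->|<-]; first by rewrite res_lift.
by rewrite lift_res; apply/finset.setP => j; rewrite !inE; case: eqP => // ->;
  rewrite (negPf mS).
Qed.

Lemma wedge_dt_coef u D : (B u \wedge dt) D = if max \in D then u (res D) else 0.
Proof.
rewrite /Defs.dt dxE wedge_basE finset.sub1set wsign_max mul1r from_base_coef resD1 !inE eqxx
  /=.
by case: ifP => _; rewrite ?mul1r ?mul0r.
Qed.

(** The block matrix diag(F, 1), written so that its algebra follows from [base_mxK] and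
    [base_mx_max]. *)
Definition cyl_mx (F : 'M[R]_n.+1) : 'M[R]_n.+2 :=
  base_mx^T *m F *m base_mx + delta_mx max max.

Lemma base_mxK : base_mx *m base_mx^T = 1%:M.
Proof.
apply/matrixP => i j; rewrite !mxE (bigD1 (lift max i)) //= !mxE eqxx mul1r big1 ?addr0.
  by rewrite (inj_eq (@lift_inj _ _)).
by move=> k /negPf ki; rewrite !mxE ki mul0r.
Qed.

Lemma base_mx_max : base_mx *m (delta_mx max max : 'M[R]_n.+2) = 0.
Proof.
apply/matrixP => i j; rewrite !mxE big1 // => k _; rewrite !mxE.
by case: eqP => [->|_]; rewrite ?mul0r // [_ == max]eq_sym (negPf (neq_lift _ _)) mulr0.
Qed.

Lemma max_base_mx : (delta_mx max max : 'M[R]_n.+2) *m base_mx^T = 0.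
Proof. by rewrite -[LHS]trmxK trmx_mul trmxK trmx_delta base_mx_max trmx0. Qed.

Lemma cyl_mxM F G : cyl_mx F *m cyl_mx G = cyl_mx (F *m G).
Proof.
rewrite /cyl_mx mulmxDl !mulmxDr !mulmxA mul_delta_mx max_base_mx !mul0mx add0r.
rewrite -[_ *m base_mx *m delta_mx _ _]mulmxA base_mx_max mulmx0 addr0.
by rewrite -[_ *m base_mx *m base_mx^T]mulmxA base_mxK mulmx1.
Qed.

Lemma cyl_mx1 : cyl_mx 1%:M = 1%:M.
Proof.
apply/matrixP => i j; rewrite /cyl_mx mulmx1 !mxE.
case: (unliftP max i) => [i' ->|->]; last first.
  rewrite big1 ?add0r; last by move=> k _; rewrite !mxE (negPf (neq_lift _ _)) mul0r.
  by rewrite eqxx eq_sym.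
rewrite (bigD1 i') //= !mxE eqxx mul1r big1 ?addr0; last first.
  by move=> k /negPf ki; rewrite !mxE (inj_eq (@lift_inj _ _)) eq_sym ki mul0r.
by rewrite [_ == max]eq_sym (negPf (neq_lift _ _)) /= addr0 eq_sym.
Qed.

Lemma cyl_mx_tr F : (cyl_mx F)^T = cyl_mx F^T.
Proof. by rewrite /cyl_mx linearD /= trmx_delta !trmx_mul trmxK mulmxA. Qed.

Lemma cyl_mx_unit F : F \in unitmx -> cyl_mx F \in unitmx.
Proof.
by move=> uF; case: (@mulmx1_unit _ _ (cyl_mx F) (cyl_mx (invmx F))) => //;
  rewrite cyl_mxM mulmxV ?cyl_mx1.
Qed.

Lemma invmx_cyl F : F \in unitmx -> invmx (cyl_mx F) = cyl_mx (invmx F).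
Proof.
move=> uF; apply: (can_inj (mulKmx (cyl_mx_unit uF))).
by rewrite mulmxV ?cyl_mx_unit // cyl_mxM mulmxV // cyl_mx1.
Qed.

Lemma pullback_cyl F u : pullback (cyl_mx F) (B u) = B (pullback F u).
Proof.
rewrite !from_baseE !pullback_comp; congr (pullback _ _).
by rewrite /cyl_mx mulmxDr base_mx_max addr0 !mulmxA base_mxK mul1mx.
Qed.

Lemma row_max_cyl F : row max (cyl_mx F) = delta_mx 0 max.
Proof.
apply/rowP => j; rewrite !mxE eqxx andTb big1 ?add0r //= => k _; rewrite !mxE big1 ?mul0r //.
by move=> i _; rewrite !mxE (negPf (neq_lift _ _)) mul0r.
Qed.

Lemma pullback_cyl_dt F : pullback (cyl_mx F) dt = dt.
Proof. by rewrite /Defs.dt pullback_dx row_max_cyl. Qed.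

Lemma coframe_metric_cyl F : coframe_metric (cyl_mx F) = cyl_mx (coframe_metric F).
Proof. by rewrite /coframe_metric cyl_mx_tr cyl_mxM. Qed.

Lemma resT : res [set: 'I_n.+2]%SET = [set: 'I_n.+1]%SET.
Proof. by apply/finset.setP => i; rewrite !inE. Qed.

Lemma bas_cylT : bas [set: 'I_n.+2]%SET = B (bas [set: 'I_n.+1]%SET) \wedge dt.
Proof.
apply/ffunP => D; rewrite wedge_dt_coef !basE; case: ifPn => mS; last first.
  by case: eqP mS => // ->; rewrite inE.
congr (nat_of_bool _)%:R; apply/eqP/eqP => [->|rS]; first exact: resT.
apply/finset.setP => j; rewrite inE; case: (unliftP max j) => [i ->|-> //].
by have := finset.in_setT i; rewrite -rS inE.
Qed.

Lemma pdet_cyl F : pdet (cyl_mx F) = pdet F.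
Proof.
by rewrite /pdet bas_cylT pullbackM pullback_cyl pullback_cyl_dt wedge_dt_coef inE resT.
Qed.

Lemma frame_star_coef m (E : 'M[R]_m) (u : ext R m) (S : {set 'I_m}) :
  frame_star E u S =
  wsign R (~: S)%SET S * pullback (invmx (coframe_metric E)) u (~: S)%SET * pdet E.
Proof. by rewrite /frame_star ffunE pullback_top basE eqxx mulr1. Qed.

Lemma coframe_metric_unit m (E : 'M[R]_m) : E \in unitmx -> coframe_metric E \in unitmx.
Proof. by move=> uE; rewrite unitmx_mul unitmx_tr uE. Qed.

Lemma frame_star_cyl F u : F \in unitmx ->
  frame_star (cyl_mx F) (B u) = B (frame_star F u) \wedge dt.
Proof.
move=> uF; apply/ffunP => D; rewrite wedge_dt_coef !frame_star_coef coframe_metric_cyl.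
rewrite invmx_cyl ?coframe_metric_unit // pullback_cyl from_base_coef pdet_cyl inE resC.
have [mS|mS] /= := boolP (max \in D); last by rewrite mulr0 mul0r.
congr (_ * _ * _); rewrite -{2}(finset.setD1K mS) -lift_res wsignUr; last first.
  by rewrite disjoints1 max_notin_lift.
rewrite wsign_max mul1r -resC.
have -> : (~: D = lift max @: res (~: D))%SET.
  rewrite lift_res; apply/finset.setP => j; rewrite !inE.
  by case: eqP => // ->; rewrite mS.
by rewrite wsign_lift res_lift.
Qed.

Lemma frame_star_cyl_dt F k u : F \in unitmx -> homog k u ->
  frame_star (cyl_mx F) (B u \wedge dt) = (-1) ^+ (n.+1 - k) *: B (frame_star F u).
Proof.
move=> uF hu; apply/ffunP => D; rewrite extZ from_base_coef !frame_star_coef coframe_metric_cyl.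
rewrite invmx_cyl ?coframe_metric_unit // pullbackM pullback_cyl pullback_cyl_dt wedge_dt_coef
  pdet_cyl inE resC.
have [mS|mS] /= := boolP (max \in D); first by rewrite !mulr0 mul0r.
rewrite !mulrA; congr (_ * _).
set c := pullback _ _ _.
(* The sign comes from dt crossing the indices of [res D]; their number is n+1-k only where the
   coefficient [c] of the k-form is nonzero. *)
have [->|c0] := eqVneq c 0; first by rewrite !(mulr0, mul0r).
have Sk : #|res D| = (n.+1 - k)%N.
  have := homog_pullback hu c0; rewrite cardsCs finset.setCK card_ord => <-.
  by rewrite subKn //; have := max_card (mem (res D)); rewrite card_ord.
congr (_ * _).
have DE : (D = lift max @: res D)%SET.
  by rewrite lift_res; apply/finset.setP => j; rewrite !inE; case: eqP => // ->;
    rewrite (negPf mS).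
have CE : (~: D = max |: lift max @: (~: res D))%SET.
  rewrite -resC lift_res finset.setD1K // inE //.
rewrite CE wsignUl; last by rewrite disjoints1 max_notin_lift.
by rewrite [X in wsign R [set max]%SET X]DE [X in wsign R (lift max @: _)%SET X]DE
  wsign_max_lift wsign_lift Sk.
Qed.

(** The volume form contributes f^m, and raising the k indices with the inverse metric contributes
    f^(-2k). *)
Lemma frame_star_scale m (E : 'M[R]_m) f k (u : ext R m) : f != 0 -> E \in unitmx -> homog k u
  ->
  frame_star (f *: E) u = (f ^+ m / f ^+ (2 * k)) *: frame_star E u.
Proof.
move=> f0 uE hu; apply/ffunP => S; rewrite extZ !frame_star_coef.
have -> : coframe_metric (f *: E) = (f ^+ 2) *: coframe_metric E.
  by rewrite /coframe_metric [(_ *: _)^T]linearZ /= -scalemxAl -scalemxAr scalerA.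
have f2 : f ^+ 2 != 0 by rewrite expf_neq0.
rewrite invmxZ ?(pullback_scale _ _ hu) ?extZ; last first.
  by rewrite -mul_scalar_mx unitmx_mul unitmxE det_scalar unitrX ?unitfE // coframe_metric_unit.
rewrite -mul_scalar_mx pdetM pdet_scalar exprVn -exprM.
by ring.
Qed.

Lemma from_base_dtC k u : homog k u -> dt \wedge B u = (-1) ^+ k *: (B u \wedge dt).
Proof. by move=> hu; rewrite (wedgeC homog_dt (homog_from_base hu)) mul1n. Qed.

Lemma dt_wedge_dt u : dt \wedge B u \wedge dt = 0.
Proof.
elim/(@ext_ind R): u => [|i u IH|c u v IHu IHv].
- by rewrite from_baseE pullback_ext1 wedge1r covec_sqr.
- rewrite from_baseM from_base_dx wedgeA /Defs.dt /dx covecC -/(dx _ _) -/(Defs.dt) !wedgeNl.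
  by rewrite -!wedgeA (wedgeA dt) IH wedge0r oppr0.
- by rewrite from_baseD from_baseZ wedgeDr wedgeDl wedgeZr wedgeZl IHu IHv scaler0 addr0.
Qed.

(** The sign is that of moving dt to the right past [u'], and the term with two factors dt
    vanishes. *)
Lemma cyl_wedge k u v u' v' : homog k u' ->
  (B u + B v \wedge dt) \wedge (B u' + B v' \wedge dt) =
  B (u \wedge u') + B (u \wedge v' + (-1) ^+ k *: (v \wedge u')) \wedge dt.
Proof.
move=> hu'; rewrite wedgeDl !wedgeDr from_baseD from_baseZ !from_baseM wedgeDl wedgeZl !wedgeA.
rewrite -[_ \wedge dt \wedge B u']wedgeA (from_base_dtC hu') wedgeZr wedgeA.
have -> : B v \wedge dt \wedge B v' \wedge dt = 0.
  by rewrite -!wedgeA (wedgeA dt) dt_wedge_dt wedge0r.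
by rewrite addr0 addrA.
Qed.

End CylinderForms.

(** Products and pull-backs become opaque atoms, after which equality of linear combinations is a
    scalar identity in each coefficient. *)
Ltac ext_combination := repeat match goal with
  | |- context [?u \wedge ?v] => generalize (u \wedge v); intro
  | |- context [from_base ?u] => generalize (from_base u); intro
  end; let S := fresh in apply/ffunP => S; rewrite !(extD, extN, extZ); field.

(** * The Hodge star of the warped structure *)

Section WarpedStar.
Context {R : realType}.
Variables (o p m : ext R 6) (f a b : R).
Hypothesis adapted : exists E, su3_adapted o p m E.
Hypotheses (f0 : f != 0) (ab : a ^+ 2 + b ^+ 2 = 1).
Local Notation B := (@from_base R 5).
Local Notation dt := (@Defs.dt R 5).
Local Notation star := (su3_star o p m).
Let E := su3_coframe o p m.
Let aa : a ^+ 2 = 1 - b ^+ 2. Proof. by rewrite -ab addrK. Qed.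

Definition warped_form : ext R 7 := f ^+ 2 *: (B o \wedge dt) + f ^+ 3 *: (a *: B p - b *: B m).

(* e^1 + i e^2 is multiplied by a + i b *)
Definition phase_mx : 'M[R]_6 := \matrix_(i, j)
  (nth [::] [:: [:: a; - b]; [:: b; a]; [:: 0; 0; 1]; [:: 0; 0; 0; 1]; [:: 0; 0; 0; 0; 1];
                [:: 0; 0; 0; 0; 0; 1]] i)`_j.

Lemma phase_mx_orth : phase_mx^T *m phase_mx = 1%:M.
Proof.
apply/matrixP => i j; rewrite !mxE !big_ord_recl big_ord0 !mxE.
rewrite -val_eqE /=; case: i => i hi /=; case: j => j hj /=.
case: i hi => [|[|[|[|[|[|i]]]]]] hi; last by [].
all: case: j hj => [|[|[|[|[|[|j]]]]]] hj; last by [].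
all: by rewrite /=; ring: aa.
Qed.

Local Notation x k := (dx R (inord k) : ext R 6).

Lemma covec_iota (c : 'rV[R]_6) : covec c = \sum_(j <- iota 0 6) c 0 (inord j) *: x j.
Proof.
rewrite covec_sum_dx -val_enum_ord big_map enumT; apply: eq_bigr => j _.
by rewrite inord_val.
Qed.

Lemma pullback_phase k : (k < 6)%N -> pullback phase_mx (x k) =
  [:: a *: x 0 - b *: x 1; b *: x 0 + a *: x 1; x 2; x 3; x 4; x 5]`_k.
Proof.
move=> k6; rewrite pullback_dx covec_iota /= !big_cons big_nil !mxE !inordK //.
case: k k6 => [|[|[|[|[|[|k]]]]]] //= _; rewrite ?scale0r ?scaleNr ?scale1r ?addr0 ?add0r //.
Qed.

Lemma dx_anticomm (i j : 'I_6) : dx R i \wedge dx R j = - (dx R j \wedge dx R i).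
Proof. exact: covecC. Qed.

Lemma phase_omega : pullback phase_mx (den 5 omega_form) = den 5 omega_form.
Proof.
rewrite /den !big_cons big_nil /mon !big_cons !big_nil !scale1r addr0 !wedge1r.
rewrite !pullbackD !pullbackM !pullback_phase //=; congr (_ + _).
rewrite wedgeBl !wedgeDr !(wedgeZl, wedgeZr) !covec_sqr (dx_anticomm (inord 1) (inord 0)).
apply/ffunP => S; rewrite !extE; ring: aa.
Qed.

(** The real part of (a + i b)(psi_+ + i psi_-). *)
Lemma phase_psip : pullback phase_mx (den 5 psip_form) = a *: den 5 psip_form - b *: den 5
  psim_form.
Proof.
rewrite /den !big_cons big_nil /mon !big_cons !big_nil /= ?scale1r addr0 !wedge1r !scaleN1r.
rewrite !(pullbackD, pullbackN) !pullbackM !pullback_phase //= !wedgeBl !wedgeDl !wedgeZl.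
by apply/ffunP => S; rewrite !extE; ring.
Qed.

Let phase_unit : phase_mx *m E \in unitmx.
Proof.
have [uE _ _ _] := su3_coframeP adapted.
by rewrite unitmx_mul uE andbT; have [] := mulmx1_unit phase_mx_orth.
Qed.

Let scaled_unit : f *: (phase_mx *m E) \in unitmx.
Proof.
by rewrite -mul_scalar_mx unitmx_mul phase_unit andbT unitmxE det_scalar unitrX ?unitfE.
Qed.

Lemma from_base_den (F : form) : all (fun t => all (fun i => i < 6)%N t.1) F ->
  B (den 5 F) = den 6 F.
Proof.
move=> /allP F6; rewrite /den from_baseE pullback_sum !big_seq; apply: eq_bigr => t /F6 {F6}.
rewrite pullbackZ -from_baseE; case: t => s c /= s6; congr (_ *: _).
elim: s s6 => [|i s IH] /=; first by rewrite /mon !big_nil from_baseE pullback_ext1.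
move=> /andP[i6 /IH {}IH]; rewrite !mon_cons from_baseM IH from_base_dx;
  congr (dx R _ \wedge _).
by apply/val_inj; rewrite /= /bump !inordK ?(leqW i6) // leqNgt i6.
Qed.

Lemma phi_form_cyl : den 6 phi_form = B (den 5 omega_form) \wedge dt + B (den 5 psip_form).
Proof.
rewrite !from_base_den // /phi_form den_cat; congr (_ + _).
have -> : dt = den 6 [:: ([:: 6%N], 1)].
  rewrite /den big_seq1 scale1r /mon big_seq1 /Defs.dt; congr (dx R _).
  by apply/val_inj; rewrite /= inordK.
by rewrite -den_wedge; apply: den_eq; vm_compute.
Qed.

Lemma warped_coframe : g2_adapted warped_form (cyl_mx (f *: (phase_mx *m E))).
Proof.
have [uE oE pE mE] := su3_coframeP adapted; split; first exact: cyl_mx_unit.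
have h2 : homog 2 (den 5 omega_form : ext R 6) by apply: homog_den.
have h3 : homog 3 (den 5 psip_form : ext R 6) by apply: homog_den.
rewrite g2_phiE phi_form_cyl pullbackD pullbackM !pullback_cyl pullback_cyl_dt.
rewrite (pullback_scale _ _ h2) (pullback_scale _ _ h3) -!pullback_comp phase_omega phase_psip.
rewrite pullbackB !pullbackZ -su3_omegaE -su3_psipE -su3_psimE -oE -pE -mE.
by rewrite !(from_baseZ, from_baseD, from_baseN) wedgeZl.
Qed.

(** The rotation preserves omega, hence omega^3, which is six times the volume form. *)
Lemma phase_det : pdet phase_mx = 1.
Proof.
have := congr1 (fun u => u \wedge u \wedge u) phase_omega; rewrite -!pullbackM.
have -> : den 5 omega_form \wedge den 5 omega_form \wedge den 5 omega_form = 6%:~R *: bas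
  [set: 'I_6]%SET :> ext R 6.
  rewrite -!den_wedge -den_vol -den_scale; congr (den 5 _); by vm_compute.
move=> /(congr1 (fun u : ext R 6 => u [set: 'I_6]%SET)).
rewrite pullbackZ !extZ pullback_top basE eqxx !mulr1 => h.
by apply: (@mulfI _ (6%:~R : R)); rewrite ?intr_eq0 // mulr1.
Qed.

Lemma frame_star_phase u : frame_star (phase_mx *m E) u = star u.
Proof.
rewrite su3_starE //; apply/ffunP => S; rewrite !frame_star_coef pdetM phase_det mul1r.
by rewrite /coframe_metric trmx_mul -mulmxA (mulmxA phase_mx^T) phase_mx_orth mul1mx.
Qed.

Lemma warped_star_base k u : homog k u ->
  g2_star warped_form (B u) = (f ^+ 6 / f ^+ (2 * k)) *: (B (star u) \wedge dt).
Proof.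
move=> hu; rewrite (g2_starE _ warped_coframe) frame_star_cyl ?scaled_unit //
  (frame_star_scale f0 _ hu).
  by rewrite frame_star_phase from_baseZ wedgeZl.
exact: phase_unit.
Qed.

Lemma warped_star_dt k u : homog k u ->
  g2_star warped_form (B u \wedge dt) = ((-1) ^+ (6 - k) * (f ^+ 6 / f ^+ (2 * k))) *: B (star
    u).
Proof.
move=> hu; rewrite (g2_starE _ warped_coframe) (frame_star_cyl_dt scaled_unit hu)
  (frame_star_scale f0 _ hu).
  by rewrite frame_star_phase from_baseZ scalerA.
exact: phase_unit.
Qed.

End WarpedStar.

(** * Exterior derivatives *)

Section Calculus.
Context {R : realType}.

(** A directional derivative sees only the restriction to a line, so a partial derivative on the
    cylinder reduces to a derivative on one factor. *)
Lemma is_derive_transport (V V' : normedModType R) (g : V -> R^o) (g' : V' -> R^o) a v a' v' d :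
  (forall h : R, g' (h *: v' + a') = g (h *: v + a)) ->
  is_derive a v g d -> is_derive a' v' g' d.
Proof.
move=> gg [gd gE]; have ga : g' a' = g a by have := gg 0; rewrite !scale0r !add0r.
have E : (fun h : R => h^-1 *: ((g' \o shift a') (h *: v') - g' a')) =
         (fun h : R => h^-1 *: ((g \o shift a) (h *: v) - g a)).
  by apply/funext => h; rewrite /= gg ga.
by split; rewrite /derivable /derive E.
Qed.

Section FormDerivative.
Variables (n m : nat).
Implicit Types (w : 'rV[R]_n.+1 -> ext R m) (x v : 'rV[R]_n.+1) (e : ext R m).

Definition is_form_derive w x v e :=
  forall S : {set 'I_m}, is_derive x v (fun y => w y S : R^o) (e S).

Lemma is_form_derive_cst e x v : is_form_derive (fun=> e) x v 0.
Proof. by move=> S; rewrite ext0; exact: is_derive_cst. Qed.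

Lemma is_form_deriveD w w' x v e e' : is_form_derive w x v e -> is_form_derive w' x v e' ->
  is_form_derive (fun y => w y + w' y) x v (e + e').
Proof.
move=> we we' S; rewrite extD; under eq_fun do rewrite extD.
exact: (@is_deriveD _ _ _ (fun y => w y S : R^o) (fun y => w' y S : R^o)).
Qed.

Lemma is_derive_fsum (J : finType) (P : pred J) (g : J -> 'rV[R]_n.+1 -> R^o) x v (d : J ->
  R^o) :
  (forall j, is_derive x v (g j) (d j)) ->
  is_derive x v (fun y => \sum_(j | P j) g j y) (\sum_(j | P j) d j).
Proof.
move=> gd; have -> : (fun y => \sum_(j | P j) g j y) = \sum_(j | P j) g j.
  by apply/funext => y; rewrite fct_sumE.
by elim/big_rec2: _ => [|j d' g' _ IH]; [exact: is_derive_cst|exact: is_deriveD].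
Qed.

Lemma is_form_deriveM w w' x v e e' : is_form_derive w x v e -> is_form_derive w' x v e' ->
  is_form_derive (fun y => w y \wedge w' y) x v (e \wedge w' x + w x \wedge e').
Proof.
move=> we we' S.
rewrite extD !ffunE -big_split; under eq_fun do rewrite ffunE.
pose g A y : R^o := wsign R A (S :\: A) * w y A * w' y (S :\: A).
have gd A : is_derive x v (g A) (wsign R A (S :\: A) * e A * w' x (S :\: A)
    + wsign R A (S :\: A) * w x A * e' (S :\: A)).
  have := @is_deriveZ _ _ _ _ (wsign R A (S :\: A)) _ _ _
     (@is_deriveM _ _ _ _ _ _ _ _ (we A) (we' (S :\: A)%SET)).
  set d1 := _ *: _; set d2 := _ + _; have -> : d1 = d2;
    first by rewrite /d1 /d2 /GRing.scale /=; ring.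
  by congr (is_derive _ _ _ _); apply/funext => y; rewrite /g -mulrA.
exact: (is_derive_fsum (fun A => A \in powerset S) gd).
Qed.

End FormDerivative.

Section ExteriorDerivative.
Variable n : nat.
Implicit Types (w : 'rV[R]_n.+1 -> ext R n.+1) (x : 'rV[R]_n.+1) (e : ext R n.+1).

(** Unlike the total function [ext_d], this records that the partial derivatives of all coefficients
    exist, as the sum and product rules require. *)
Definition has_ext_d (w : 'rV[R]_n.+1 -> ext R n.+1) x (e : ext R n.+1) :=
  exists2 D : 'I_n.+1 -> ext R n.+1,
    forall i, is_form_derive w x (delta_mx 0 i) (D i) & e = \sum_i dx R i \wedge D i.

Lemma has_ext_dE w x e : has_ext_d w x e -> ext_d w x = e.
Proof.
move=> [D wD ->]; apply: eq_bigr => i _; congr (_ \wedge _); apply/ffunP => S.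
by rewrite ffunE /partial; case: (wD i S).
Qed.

Lemma ext_d_near w w' x : (\near x, w x = w' x) -> ext_d w x = ext_d w' x.
Proof.
move=> ww; apply: eq_bigr => i _; congr (_ \wedge _); apply/ffunP => S.
rewrite !ffunE /partial; apply: (@near_eq_derive R _ R^o).
by apply: filterS ww => y ->.
Qed.

Lemma has_ext_dD w w' x e e' : has_ext_d w x e -> has_ext_d w' x e' ->
  has_ext_d (fun y => w y + w' y) x (e + e').
Proof.
move=> [D wD ->] [D' wD' ->]; exists (fun i => D i + D' i); first by move=> i;
  exact: is_form_deriveD.
by rewrite -big_split; apply: eq_bigr => i _; rewrite wedgeDr.
Qed.

Lemma has_ext_d_wedge_cst w x e u : has_ext_d w x e -> has_ext_d (fun y => w y \wedge u) x (e
  \wedge u).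
Proof.
move=> [D wD ->]; exists (fun i => D i \wedge u).
  move=> i; have := is_form_deriveM (wD i) (@is_form_derive_cst _ _ u x (delta_mx 0 i)).
  by rewrite wedge0r addr0.
by rewrite wedge_suml; apply: eq_bigr => i _; rewrite wedgeA.
Qed.

Lemma has_ext_d_sqr2 w x e : homog 2 (w x) -> has_ext_d w x e ->
  has_ext_d (fun y => w y \wedge w y) x (2 *: (w x \wedge e)).
Proof.
move=> w2 [D wD ->]; exists (fun i => D i \wedge w x + w x \wedge D i).
  by move=> i; apply: is_form_deriveM.
rewrite wedge_sumr scaler_sumr; apply: eq_bigr => i _.
have w_dx : dx R i \wedge w x = w x \wedge dx R i.
  by rewrite (wedgeC (@homog_covec _ _ _) w2) expr2 mulrNN mulr1 scale1r.
(* A 2-form commutes with every form. [D i] is not known to be homogeneous, so this is applied to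
   its monomials. *)
have commute k u : homog k u -> u \wedge w x = w x \wedge u.
  by move=> hu; rewrite (wedgeC hu w2) exprM sqrr_sign scale1r.
have -> : D i \wedge w x = w x \wedge D i.
  rewrite (ext_basis (D i)) wedge_suml wedge_sumr; apply: eq_bigr => S _.
  by rewrite wedgeZl wedgeZr (commute _ _ (@homog_bas _ _ S)).
by rewrite wedgeDr !wedgeA w_dx [LHS]scaler_nat.
Qed.

Lemma smooth_has_ext_d (U : set 'rV[R]_n.+1) w x : U x ->
  (forall S : {set 'I_n.+1}, smooth_on U (fun y => w y S)) -> has_ext_d w x (ext_d w x).
Proof.
move=> Ux wU; eexists; last by [].
move=> i S; rewrite ffunE; apply: derivableP.
by have [/(_ x Ux) + _] := wU S 1%N; exact: diff_derivable.
Qed.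
End ExteriorDerivative.

(** * Exterior derivatives on the cylinder *)

Section CylinderDerivative.
Variable n : nat.
Local Notation B := (@from_base R n).
Local Notation dt := (@Defs.dt R n).
Local Notation max := (@ord_max n.+1).
Implicit Types (z : 'rV[R]_n.+2).

Lemma base_line (h : R) k z :
  base (h *: delta_mx 0 (lift max k) + z) = h *: delta_mx 0 k + base z.
Proof. by apply/rowP => i; rewrite !mxE !eqxx (inj_eq (@lift_inj _ _)). Qed.

Lemma base_line_max (h : R) z : base (h *: delta_mx 0 max + z) = base z.
Proof. by apply/rowP => i; rewrite !mxE [_ == max]eq_sym (negPf (neq_lift _ _)) andbF mulr0
  add0r. Qed.

Lemma time_line (h : R) k z : time (h *: delta_mx 0 (lift max k) + z) = time z.
Proof. by rewrite /time !mxE (negPf (neq_lift _ _)) andbF mulr0 add0r. Qed.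

Lemma time_line_max (h : R) z : time (h *: delta_mx 0 max + z) = h *: 1 + time z.
Proof. by rewrite /time !mxE !eqxx. Qed.

Lemma has_ext_d_cylinder (c : R -> R) (w : 'rV[R]_n.+1 -> ext R n.+1) z c' e :
  is_derive (time z) 1 (c : R -> R^o) c' -> has_ext_d w (base z) e ->
  has_ext_d (fun y => c (time y) *: B (w (base y))) z
    (c' *: (dt \wedge B (w (base z))) + c (time z) *: B e).
Proof.
move=> cd [D wD ->].
(* Along a base direction only [w] varies, and along t only [c]. *)
exists (fun j => if unlift max j is Some k then c (time z) *: B (D k) else c' *: B (w (base
  z))).
  move=> j S; case: unliftP => [k ->|->]; rewrite extZ from_base_coef.
    under eq_fun do rewrite extZ from_base_coef.
    case: ifP => _; first by rewrite mulr0; under eq_fun do rewrite mulr0; exact: is_derive_cst.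
    apply: (is_derive_transport _ (@is_deriveZ _ _ _ _ (c (time z)) _ _ _ (wD k (res S)))).
    by move=> h; rewrite time_line base_line.
  under eq_fun do rewrite extZ from_base_coef.
  case: ifP => _; first by rewrite mulr0; under eq_fun do rewrite mulr0; exact: is_derive_cst.
  rewrite mulrC; apply: (is_derive_transport _ (@is_deriveZ _ _ _ _ (w (base z) (res S)) _ _ _
    cd)).
  by move=> h; rewrite time_line_max base_line_max mulrC.
rewrite (bigD1 max) //= unlift_none wedgeZr; congr (_ + _).
rewrite from_baseE pullback_sum scaler_sumr; apply/esym.
rewrite (reindex_omap (lift max) (unlift max)) /=; last first.
  by move=> i; case: unliftP => [k ->|->]; rewrite ?eqxx.
apply: eq_big => [k|k _]; first by rewrite liftK eqxx eq_sym neq_lift.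
by rewrite liftK wedgeZr -from_baseE from_baseM from_base_dx.
Qed.

Lemma has_ext_d_cylinder_dt (c : R -> R) (w : 'rV[R]_n.+1 -> ext R n.+1) z c' e :
  is_derive (time z) 1 (c : R -> R^o) c' -> has_ext_d w (base z) e ->
  has_ext_d (fun y => c (time y) *: (B (w (base y)) \wedge dt)) z
    (c (time z) *: (B e \wedge dt)).
Proof.
move=> cd /(has_ext_d_cylinder cd)/(has_ext_d_wedge_cst dt).
rewrite wedgeDl !wedgeZl dt_wedge_dt scaler0 add0r.
by under eq_fun do rewrite wedgeZl.
Qed.

End CylinderDerivative.

End Calculus.

(** * The torsion of a warped structure *)

Section Pointwise.
Context {R : realType}.
Variables (o p m : ext R 6) (f a b : R).
Hypothesis adapted : exists E, su3_adapted o p m E.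
Hypotheses (f0 : f != 0) (ab : a ^+ 2 + b ^+ 2 = 1).
Local Notation B := (@from_base R 5).
Local Notation dt := (@Defs.dt R 5).
Local Notation star := (su3_star o p m).
Local Notation phi := (warped_form o p m f a b).

Let aa : a ^+ 2 = 1 - b ^+ 2. Proof. by rewrite -ab addrK. Qed.

Let starD u v : star (u + v) = star u + star v. Proof. exact: linearD. Qed.
Let starZ c u : star (c *: u) = c *: star u. Proof. exact: linearZ. Qed.
Let starN u : star (- u) = - star u. Proof. exact: linearN. Qed.

(* Otherwise unification unfolds sums of forms into finite functions and becomes
   prohibitively slow. *)
Local Opaque ffun_scale ffun_add ffun_opp ffun_zero su3_star wedge from_base g2_star.

Lemma su3_homog : [/\ homog 2 o, homog 3 p & homog 3 m].
Proof.
have [_ -> -> ->] := su3_coframeP adapted.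
by split; rewrite (su3_omegaE, su3_psipE, su3_psimE); apply: homog_pullback; apply: homog_den.
Qed.

Let ho : homog 2 o. Proof. by case: su3_homog. Qed.
Let hp : homog 3 p. Proof. by case: su3_homog. Qed.
Let hm : homog 3 m. Proof. by case: su3_homog. Qed.
Let hoo : homog 4 (o \wedge o). Proof. exact: (homog_wedge ho ho). Qed.

Lemma homog_star k u : homog k u -> homog (6 - k) (star u).
Proof.
move=> hu S; rewrite su3_starE // frame_star_coef !mulf_eq0 !negb_or => /andP[/andP[_ h] _].
have := homog_pullback hu h; rewrite cardsCs finset.setCK card_ord => <-.
by rewrite subKn //; have := max_card (mem S); rewrite card_ord.
Qed.

Let psi := a *: p - b *: m.
Let hpsi : homog 3 psi. Proof. by apply: homogB; apply: homogZ. Qed.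

Let star_o : star o = 2^-1 *: (o \wedge o).
Proof. by rewrite -(su3_star_omega adapted) scalerA mulVf ?pnatr_eq0 // scale1r. Qed.

Lemma warped_formE : phi = B (f ^+ 3 *: psi) + B (f ^+ 2 *: o) \wedge dt.
Proof.
rewrite /warped_form /psi !from_baseZ from_baseD from_baseN !from_baseZ wedgeZl.
by rewrite addrC.
Qed.

(** The factor f^6 / f^(2k) is 1 for k = 3 and f^2 for k = 2; in the latter case the sign (-1)^(6-2)
    is trivial. *)
Lemma warped_star_cyl u v : homog 3 u -> homog 2 v ->
  g2_star phi (B u + B v \wedge dt) = B (f ^+ 2 *: star v) + B (star u) \wedge dt.
Proof.
move=> hu hv; rewrite (g2_starE _ (warped_coframe adapted f0 ab)) linearD /=.
rewrite -!(g2_starE _ (warped_coframe adapted f0 ab)) (warped_star_base adapted f0 ab hu).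
rewrite (warped_star_dt adapted f0 ab hv) from_baseZ addrC divff ?expf_neq0 // scale1r.
congr (_ *: _ + _); rewrite -signr_odd mul1r.
by apply: (@mulIf _ (f ^+ 4)); rewrite ?expf_neq0 // divfK ?expf_neq0 // -exprD.
Qed.

Lemma star_warped_form : g2_star phi phi =
  B ((f ^+ 4 / 2) *: (o \wedge o)) + B (f ^+ 3 *: (a *: m + b *: p)) \wedge dt.
Proof.
rewrite {2}warped_formE warped_star_cyl; [|exact: homogZ|exact: homogZ].
rewrite !starZ star_o /psi starD starN !starZ (su3_star_psip adapted) (su3_star_psim adapted).
congr (B _ + B _ \wedge dt); apply/ffunP => S; rewrite !extE; first by field.
by ring.
Qed.

Section Torsion.
Variables (p0 s0 f' k : R) (p1 n1 p2 s2 n3 : ext R 6).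
Hypotheses (hp1 : homog 1 p1) (hn1 : homog 1 n1) (hp2 : homog 2 p2) (hs2 : homog 2 s2)
  (hn3 : homog 3 n3) (p28 : su3_type28 o p m p2) (s28 : su3_type28 o p m s2)
  (n312 : su3_type312 o p m n3).

(* Since a a' + b b' = 0, the derivatives are a' = - b k and b' = a k for
   k = a b' - b a'. *)
Let a' := - (b * k).
Let b' := a * k.

Definition warped_tau0 := 4 / (7 * f) * (3 * p0 * a - 3 * s0 * b + f * a * b' - f * b * a').
Definition warped_tau1_base := (1 / 6) *: n1 + (1 / 6) *: p1.
Definition warped_tau1_dt := 1 / (2 * f) * (p0 * b + s0 * a + 2 * f').
Definition warped_tau2_base := - (1 / 3 * f * b) *: star (p1 \wedge p) - (1 / 3 * f * a) *:
  star (p1 \wedge m)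
  + (2 / 3 * f * b) *: star (n1 \wedge p) + (2 / 3 * f * a) *: star (n1 \wedge m)
  - (f * b) *: p2 - (f * a) *: s2.
Definition warped_tau2_dt := - (2 / 3) *: star (n1 \wedge (o \wedge o)) + (1 / 3) *: star (p1
  \wedge (o \wedge o)).
Definition warped_tau3_base := - (3 / 14 * f ^+ 2 * (p0 * a ^+ 2 - s0 * a * b - 2 * f * b'))
  *: p
  + (3 / 14 * f ^+ 2 * (p0 * a * b - s0 * b ^+ 2 + 2 * f * a')) *: m
  - (1 / 2 * f ^+ 2) *: star (n1 \wedge o) + (1 / 2 * f ^+ 2) *: star (p1 \wedge o)
  - f ^+ 2 *: star n3.
Definition warped_tau3_dt := (2 / 7 * f * (p0 * a - s0 * b - 2 * f * a * b' + 2 * f * b * a'))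
  *: o
  + (1 / 2 * f * a) *: star (p1 \wedge p) - (1 / 2 * f * b) *: star (p1 \wedge m)
  - (1 / 2 * f * a) *: star (n1 \wedge p) + (1 / 2 * f * b) *: star (n1 \wedge m)
  + f *: (a *: p2 - b *: s2).
(** The function multiplying dt is entered as a 0-form, so that [cyl_wedge] applies as in the other
    degrees. *)
Definition warped_tau1 := B warped_tau1_base + B (warped_tau1_dt *: ext1 R 6) \wedge dt.
Definition warped_tau2 := B warped_tau2_base + B warped_tau2_dt \wedge dt.
Definition warped_tau3 := B warped_tau3_base + B warped_tau3_dt \wedge dt.

Let hgp g : homog 1 g -> homog 4 (g \wedge p). Proof. by move=> /homog_wedge/(_ hp). Qed.
Let hgm g : homog 1 g -> homog 4 (g \wedge m). Proof. by move=> /homog_wedge/(_ hm). Qed.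
Let hgo g : homog 1 g -> homog 3 (g \wedge o). Proof. by move=> /homog_wedge/(_ ho). Qed.
Let hgoo g : homog 1 g -> homog 5 (g \wedge (o \wedge o)). Proof. by move=> /homog_wedge/(_
  hoo). Qed.

Ltac homog_linear := repeat match goal with
  | |- homog _ (_ + _) => apply: homogD
  | |- homog _ (- _) => apply: homogN
  | |- homog _ (_ *: _) => apply: homogZ
  | |- homog _ (su3_star _ _ _ (_ \wedge p)) => refine (homog_star (hgp _))
  | |- homog _ (su3_star _ _ _ (_ \wedge m)) => refine (homog_star (hgm _))
  | |- homog _ (su3_star _ _ _ (_ \wedge o)) => refine (homog_star (hgo _))
  | |- homog _ (su3_star _ _ _ (_ \wedge (o \wedge o))) => refine (homog_star (hgoo _))
  | |- homog _ (su3_star _ _ _ n3) => exact (homog_star hn3)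
  | |- homog _ _ => assumption
  end.

Let hA2 : homog 2 warped_tau2_base. Proof. by rewrite /warped_tau2_base; homog_linear. Qed.
Let hC2 : homog 1 warped_tau2_dt. Proof. by rewrite /warped_tau2_dt; homog_linear. Qed.
Let hA3 : homog 3 warped_tau3_base. Proof. by rewrite /warped_tau3_base; homog_linear. Qed.
Let hC3 : homog 2 warped_tau3_dt. Proof. by rewrite /warped_tau3_dt; homog_linear. Qed.

Lemma homog_warped_tau : [/\ homog 1 warped_tau1, homog 2 warped_tau2 & homog 3 warped_tau3].
Proof.
split; apply: homogD; try exact: homog_from_base.
- by apply: homog_from_base; apply: homogD; apply: homogZ.
- apply: (@homog_wedge _ _ 0 1 _ _ _ (@homog_dt R 5)); apply: homog_from_base; apply: homogZ.
  exact: homog_ext1.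
- by apply: (@homog_wedge _ _ 1 1 _ _ _ (@homog_dt R 5)); apply: homog_from_base.
- by apply: (@homog_wedge _ _ 2 1 _ _ _ (@homog_dt R 5)); apply: homog_from_base.
Qed.

Let n3o : n3 \wedge o = 0. Proof. by case: n312. Qed.
Let n3p : n3 \wedge p = 0. Proof. by case: n312. Qed.
Let n3m : n3 \wedge m = 0. Proof. by case: n312. Qed.
Let sn3o : star n3 \wedge o = 0.
Proof.
have := su3_star3_omega adapted hn3; rewrite n3o [star 0]linear0 wedge0l => /eqP.
by rewrite scaler_eq0 pnatr_eq0 => /eqP.
Qed.
Let sn3p : star n3 \wedge p = 0. Proof. by rewrite (su3_star3_psip adapted hn3) n3m oppr0. Qed.
Let sn3m : star n3 \wedge m = 0. Proof. by rewrite (su3_star3_psim adapted hn3) n3p. Qed.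

Let p2oo : p2 \wedge (o \wedge o) = 0. Proof. by case: p28. Qed.
Let s2oo : s2 \wedge (o \wedge o) = 0. Proof. by case: s28. Qed.

Let mp : m \wedge p = - (p \wedge m). Proof. exact: (su3_psim_psip adapted). Qed.
Let ooo : o \wedge (o \wedge o) = (3 / 2) *: (p \wedge m).
Proof.
have h : 2 != 0 :> R by rewrite pnatr_eq0.
by apply: (scalerI h); rewrite (su3_omega3 adapted) scalerA mulrCA divff // mulr1.
Qed.
Let po : p \wedge o = 0. Proof. by rewrite (wedgeC hp ho) (su3_omega_psip adapted) scaler0. Qed.
Let mo : m \wedge o = 0. Proof. by rewrite (wedgeC hm ho) (su3_omega_psim adapted) scaler0. Qed.

(** The products with omega or omega^2, and below with psi_+-, that arise when the torsion forms are
    multiplied by phi or star phi. *)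
Let star_o_rules := (su3_star_psip_omega2 adapted hp1, su3_star_psim_omega2 adapted hp1,
  su3_star_psip_omega2 adapted hn1, su3_star_psim_omega2 adapted hn1,
  su3_star_omega2_omega2 adapted hp1, su3_star_omega2_omega2 adapted hn1,
  su3_star_psip_omega adapted hp1, su3_star_psip_omega adapted hn1,
  su3_star_psim_omega adapted hp1, su3_star_psim_omega adapted hn1,
  su3_star_omega_omega adapted hp1, su3_star_omega_omega adapted hn1,
  p2oo, s2oo, sn3o, ooo, po, mo).
Let star_psi_rules := (su3_star_psip_psip adapted hp1, su3_star_psip_psip adapted hn1,
  su3_star_psip_psim adapted hp1, su3_star_psip_psim adapted hn1,
  su3_star_psim_psip adapted hp1, su3_star_psim_psip adapted hn1,
  su3_star_psim_psim adapted hp1, su3_star_psim_psim adapted hn1,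
  su3_star_omega2_psip adapted hp1, su3_star_omega2_psip adapted hn1,
  su3_star_omega2_psim adapted hp1, su3_star_omega2_psim adapted hn1,
  su3_star_omega_psip adapted hp1, su3_star_omega_psip adapted hn1,
  su3_star_omega_psim adapted hp1, su3_star_omega_psim adapted hn1,
  su3_type28_psip adapted hp2 p28, su3_type28_psip adapted hs2 s28,
  su3_type28_psim adapted hp2 p28, su3_type28_psim adapted hs2 s28,
  su3_omega_psip adapted, su3_omega_psim adapted,
  su3_psip_psip adapted, su3_psim_psim adapted, sn3p, sn3m, mp).

(** The scalar identities hold modulo a^2 + b^2 = 1, passed to [field] as a rule eliminating a^2. *)
Ltac ext_field := repeat match goal with
  | |- context [?x \wedge ?y] => generalize (x \wedge y); intro
  | |- context [su3_star _ _ _ ?x] => generalize (star x); intro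
  end; let S := fresh in apply/ffunP => S; rewrite !(extD, extN, extZ, ext0); field: aa.

(** The stars are generalized in the goal and in the rules together, so that rewriting matches
    variables only. *)
Ltac expand_stars := move: star_o_rules star_psi_rules;
  repeat match goal with |- context [su3_star _ _ _ ?x] => generalize (star x); intro end;
  let ro := fresh in let rp := fresh in move=> ro rp;
  rewrite ?wedgeZr ?wedgeDr ?wedgeNr ?wedgeZr ?wedgeDl ?wedgeNl ?wedgeZl;
  rewrite ?wedgeDl ?wedgeNl ?wedgeZl ?ro ?rp.

Lemma warped_tau2_type : g2_type214 phi warped_tau2.
Proof.
rewrite /g2_type214 star_warped_form (cyl_wedge _ _ _ (@homogZ _ _ 4 _ _ hoo)).
set u := (X in B X + _); set v := (X in B X \wedge dt).
have -> : u = 0.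
  by rewrite /u /warped_tau2_base; expand_stars; rewrite !(scaler0, oppr0, addr0).
suff -> : v = 0 by rewrite from_base0 wedge0l addr0.
by rewrite /v /warped_tau2_base /warped_tau2_dt; expand_stars; ext_field.
Qed.

Lemma warped_tau3_type : g2_type327 phi warped_tau3.
Proof.
split.
  rewrite warped_formE (cyl_wedge _ _ _ (@homogZ _ _ 3 _ _ hpsi)).
  set u := (X in B X + _); set v := (X in B X \wedge dt).
  have -> : u = 0.
    by rewrite /u /warped_tau3_base /psi; expand_stars; rewrite /a' /b'; ext_field.
  suff -> : v = 0 by rewrite from_base0 wedge0l addr0.
  by rewrite /v /warped_tau3_base /warped_tau3_dt /psi; expand_stars; rewrite /a' /b';
    ext_field.
rewrite star_warped_form (cyl_wedge _ _ _ (@homogZ _ _ 4 _ _ hoo)).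
set u := (X in B X + _); set v := (X in B X \wedge dt).
have -> : u = 0.
  (* This component is a form of degree 7 in dimension 6. *)
  apply/ffunP => S; rewrite ext0 /u; apply/eqP; apply: contraT.
  move=> /(homog_wedge hA3 (@homogZ _ _ 4 _ _ hoo)) S7.
  by have := max_card (mem S); rewrite S7 card_ord.
suff -> : v = 0 by rewrite from_base0 wedge0l addr0.
by rewrite /v /warped_tau3_base /warped_tau3_dt; expand_stars; rewrite /a' /b'; ext_field.
Qed.

Lemma cyl_add (u v u' v' : ext R 6) : (B u + B v \wedge dt) + (B u' + B v' \wedge dt) =
  B (u + u') + B (v + v') \wedge dt.
Proof. by rewrite !from_baseD wedgeDl addrACA. Qed.

Lemma cyl_scale c (u v : ext R 6) : c *: (B u + B v \wedge dt) = B (c *: u) + B (c *: v)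
  \wedge dt.
Proof. by rewrite !from_baseZ wedgeZl scalerDr. Qed.

Let dO := - (3 / 2 * s0) *: p + (3 / 2 * p0) *: m + n1 \wedge o + n3.
Let dP := p0 *: (o \wedge o) + p1 \wedge p - p2 \wedge o.
Let dM := s0 *: (o \wedge o) + p1 \wedge m - s2 \wedge o.

(** The equation for d phi contains the star of tau_3, whose formula already contains stars; these
    rules undo the double ones. *)
Let star_star_rules := (su3_star_psip adapted, su3_star_psim adapted, star_o,
  su3_starK4 adapted (hgp hp1), su3_starK4 adapted (hgm hp1),
  su3_starK4 adapted (hgp hn1), su3_starK4 adapted (hgm hn1),
  su3_starK3 adapted (hgo hp1), su3_starK3 adapted (hgo hn1), su3_starK3 adapted hn3,
  su3_type28_star adapted hp2 p28, su3_type28_star adapted hs2 s28).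

(** The left-hand side is the derivative found in [ext_d_warped_g2], with d omega and d psi_+-
    replaced by their torsion expressions. *)
Lemma warped_d_phi :
  B (f ^+ 3 *: (a *: dP - b *: dM)) +
  B (f ^+ 2 *: dO - (3 * f ^+ 2 * f' * a + f ^+ 3 * a') *: p
     + (3 * f ^+ 2 * f' * b + f ^+ 3 * b') *: m) \wedge dt =
  warped_tau0 *: g2_star phi phi + 3 *: (warped_tau1 \wedge phi) + g2_star phi warped_tau3.
Proof.
rewrite star_warped_form warped_formE (cyl_wedge _ _ _ (@homogZ _ _ 3 _ _ hpsi)) -warped_formE.
rewrite (warped_star_cyl hA3 hC3) !cyl_scale !cyl_add.
congr (B _ + B _ \wedge dt).
  rewrite /warped_tau3_dt !starD !starN !starZ !starD !starN !starZ !star_star_rules.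
  rewrite /dP /dM /warped_tau1_base /psi ?wedgeZr ?wedgeDr ?wedgeNr ?wedgeZr ?wedgeDl ?wedgeNl
    ?wedgeZl.
  by rewrite /warped_tau0 /a' /b'; ext_field.
rewrite /warped_tau3_base !starD !starN !starZ !star_star_rules.
rewrite /dO /warped_tau1_base /psi ?wedgeZr ?wedgeDr ?wedgeNr ?wedgeZr ?wedgeDl ?wedgeNl
  ?wedgeZl ?wedge1l.
by rewrite /warped_tau0 /warped_tau1_dt /a' /b'; ext_field.
Qed.

Lemma warped_d_star_phi :
  B (f ^+ 4 *: (o \wedge dO)) +
  B ((2 * f ^+ 3 * f') *: (o \wedge o) + f ^+ 3 *: (a *: dM + b *: dP)) \wedge dt =
  4 *: (warped_tau1 \wedge g2_star phi phi) + warped_tau2 \wedge phi.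
Proof.
rewrite star_warped_form warped_formE (cyl_wedge _ _ _ (@homogZ _ _ 3 _ _ hpsi)).
rewrite (cyl_wedge _ _ _ (@homogZ _ _ 4 _ _ hoo)) !cyl_scale !cyl_add.
have on1 : o \wedge (n1 \wedge o) = n1 \wedge (o \wedge o).
  by rewrite (wedgeC ho (hgo hn1)) -signr_odd scale1r -wedgeA.
have on3 : o \wedge n3 = 0 by rewrite (wedgeC ho hn3) n3o scaler0.
congr (B _ + B _ \wedge dt).
  rewrite /dO /warped_tau2_base /warped_tau1_base /psi; expand_stars; rewrite ?on1 ?on3.
  by ext_field.
rewrite /dP /dM /warped_tau2_base /warped_tau2_dt /warped_tau1_base /warped_tau1_dt /psi;
  expand_stars; rewrite ?wedge1l.
by ext_field.
Qed.
Lemma warped_tau1E : warped_tau1 = warped_tau1_dt *: dt + (1 / 6) *: B n1 + (1 / 6) *: B p1.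
Proof.
rewrite /warped_tau1 /warped_tau1_base from_baseD !from_baseZ wedgeZl (_ : B (ext1 R 6) = ext1
  R 7).
  by rewrite wedge1l addrC addrA.
exact: pullback_ext1.
Qed.

Lemma warped_tau2E : warped_tau2 =
  - (2 / 3) *: (B (star (n1 \wedge (o \wedge o))) \wedge dt)
  + (1 / 3) *: (B (star (p1 \wedge (o \wedge o))) \wedge dt)
  - (1 / 3 * f * b) *: B (star (p1 \wedge p)) - (1 / 3 * f * a) *: B (star (p1 \wedge m))
  + (2 / 3 * f * b) *: B (star (n1 \wedge p)) + (2 / 3 * f * a) *: B (star (n1 \wedge m))
  - (f * b) *: B p2 - (f * a) *: B s2.
Proof.
rewrite /warped_tau2 /warped_tau2_base /warped_tau2_dt;
  do ?rewrite ?from_baseD ?from_baseN ?from_baseZ.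
by rewrite ?wedgeDl ?wedgeZl; ext_combination.
Qed.

Lemma warped_tau3E : warped_tau3 =
  - (3 / 14 * f ^+ 2 * (p0 * a ^+ 2 - s0 * a * b - 2 * f * b')) *: B p
  + (3 / 14 * f ^+ 2 * (p0 * a * b - s0 * b ^+ 2 + 2 * f * a')) *: B m
  + (2 / 7 * f * (p0 * a - s0 * b - 2 * f * a * b' + 2 * f * b * a')) *: (B o \wedge dt)
  - (1 / 2 * f ^+ 2) *: B (star (n1 \wedge o)) + (1 / 2 * f ^+ 2) *: B (star (p1 \wedge o))
  + (1 / 2 * f * a) *: (B (star (p1 \wedge p)) \wedge dt)
  - (1 / 2 * f * b) *: (B (star (p1 \wedge m)) \wedge dt)
  - (1 / 2 * f * a) *: (B (star (n1 \wedge p)) \wedge dt)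
  + (1 / 2 * f * b) *: (B (star (n1 \wedge m)) \wedge dt)
  + f *: (B (a *: p2 - b *: s2) \wedge dt) - f ^+ 2 *: B (star n3).
Proof.
rewrite /warped_tau3 /warped_tau3_base /warped_tau3_dt; move: (a *: p2 - b *: s2) => q;
  do ?rewrite ?from_baseD ?from_baseN ?from_baseZ.
by rewrite ?wedgeDl ?wedgeNl ?wedgeZl; ext_combination.
Qed.

End Torsion.
End Pointwise.

(** * Derivatives of the warped structure, and the torsion formulas *)

Section Main.
Context {R : realType}.

Lemma base_join n (x : 'rV[R]_n.+1) t : base (join_t x t) = x.
Proof. by apply/rowP => k; rewrite !mxE liftK. Qed.

Lemma time_join n (x : 'rV[R]_n.+1) t : time (join_t x t) = t.
Proof. by rewrite /time mxE unlift_none. Qed.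

Lemma join_base_time n (z : 'rV[R]_n.+2) : join_t (base z) (time z) = z.
Proof. by apply/rowP => j; rewrite !mxE; case: unliftP => [k ->|->] //; rewrite mxE. Qed.

Lemma cod_cylinder n (T : topologicalType) (I : set R) (L : atlas R n T) (i : chart L) z :
  cod (i : chart (cylinder I L)) z <-> cod i (base z) /\ I (time z).
Proof.
split=> [[[q t] /= [qi It] <-]|[[q qi qz] It]]; first by rewrite base_join time_join;
  split=> //; exists q.
by exists (q, time z); [split | rewrite /= qz join_base_time].
Qed.

Lemma near_base_time n (U : set 'rV[R]_n.+1) (I : set R) z :
  open U -> open I -> U (base z) -> I (time z) -> \forall y \near z, U (base y) /\ I (time y).
Proof.
move=> oU oI Uz Iz.
have /nbhs_ballP[e /= e0 eU] : nbhs (base z) U by exact: open_nbhs_nbhs.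
have /nbhs_ballP[d /= d0 dI] : nbhs (time z) I by exact: open_nbhs_nbhs.
apply/nbhs_ballP; exists (Num.min e d) => /=; first by rewrite lt_min e0 d0.
move=> y [_ zy]; split.
  apply: eU; split=> // i j; rewrite !mxE; apply: le_ball (zy _ _).
  by rewrite ge_min lexx.
by apply: (dI (time y)); apply: le_ball (zy _ _); rewrite ge_min lexx orbT.
Qed.

Lemma smooth_on_interval_derivable (I : set R) g t : smooth_on_interval I g -> I t ->
  is_derive t 1 (g : R -> R^o) (derive1 g t).
Proof. by move=> /(_ 0%N t) + It => /(_ It) dg; rewrite derive1E; apply: derivableP. Qed.

Lemma circle_derivative (I : set R) (a b : R -> R) t : open I -> I t ->
  (forall s, I s -> a s ^+ 2 + b s ^+ 2 = 1) ->
  smooth_on_interval I a -> smooth_on_interval I b ->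
  a t * derive1 a t + b t * derive1 b t = 0.
Proof.
move=> oI It ab sa sb.
have da := smooth_on_interval_derivable sa It; have db := smooth_on_interval_derivable sb It.
have := is_deriveD (is_deriveX 2 da) (is_deriveX 2 db).
(* The circle relation is known only on I, hence near t; the derivative of the sum of squares is
   twice the expression sought. *)
move=> [_]; rewrite (@near_eq_derive R _ R^o _ (cst 1)).
  rewrite derive_cst /GRing.scale /= !expr1 => h.
  by apply: (@mulfI R 2); rewrite ?pnatr_eq0 // mulr0 h; ring.
have : nbhs t I by exact: open_nbhs_nbhs.
by apply: filterS => s Is; rewrite -(ab s Is).
Qed.

Section Warped.
Variables (T : topologicalType) (L : atlas R 5 T).
Variables (om psip psim : ext_field L) (I : set R) (f alpha beta : R -> R).
Hypotheses (manL : smooth_manifold L) (su3L : su3_structure om psip psim).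
Hypotheses (openI : open I).
Hypotheses (smooth_f : smooth_on_interval I f) (smooth_alpha : smooth_on_interval I alpha)
  (smooth_beta : smooth_on_interval I beta).
Hypotheses (f_neq0 : forall t, I t -> f t != 0).
Hypotheses (alpha_beta : forall t, I t -> alpha t ^+ 2 + beta t ^+ 2 = 1).
Variables (i : chart L) (z : 'rV[R]_7).
Hypotheses (zi : cod i (base z)) (zI : I (time z)).
Local Notation B := (@from_base R 5).
Local Notation dt := (@Defs.dt R 5).
Local Notation phi := (warped_g2 (I := I) f alpha beta om psip psim i).
Local Notation x := (base z).
Local Notation t := (time z).

Lemma su3_structure_adapted y : cod i y -> exists E, su3_adapted (om i y) (psip i y) (psim i
  y) E.
Proof.
by case: su3L => _ _ _ /(_ i y) + yi => /(_ yi) [U [E [_ Uy _ _ /(_ y Uy) h]]]; exists (E y).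
Qed.

Lemma warped_g2E y : phi y = warped_form (om i (base y)) (psip i (base y)) (psim i (base y))
  (f (time y)) (alpha (time y)) (beta (time y)).
Proof. by []. Qed.

Let dom k w : diff_form k w -> has_ext_d (w i) x (ext_d (w i) x).
Proof. by move=> [sw _ _]; apply: smooth_has_ext_d zi _ => S; exact: sw. Qed.

Let df := smooth_on_interval_derivable smooth_f zI.
Let da := smooth_on_interval_derivable smooth_alpha zI.
Let db := smooth_on_interval_derivable smooth_beta zI.

Let dfa : is_derive t 1 (fun s => f s ^+ 3 * alpha s : R^o)
  (3 * f t ^+ 2 * derive1 f t * alpha t + f t ^+ 3 * derive1 alpha t).
Proof.
apply: is_derive_eq (is_deriveM (is_deriveX 3 df) da) _.
by rewrite exprfctE /GRing.scale /=; ring.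
Qed.
Let dfb : is_derive t 1 (fun s => f s ^+ 3 * beta s : R^o)
  (3 * f t ^+ 2 * derive1 f t * beta t + f t ^+ 3 * derive1 beta t).
Proof.
apply: is_derive_eq (is_deriveM (is_deriveX 3 df) db) _.
by rewrite exprfctE /GRing.scale /=; ring.
Qed.
Let dfnb : is_derive t 1 (fun s => - (f s ^+ 3 * beta s) : R^o)
  (- (3 * f t ^+ 2 * derive1 f t * beta t + f t ^+ 3 * derive1 beta t)).
Proof. exact: is_deriveN. Qed.
Let df2 : is_derive t 1 (fun s => f s ^+ 2 : R^o) (2 * f t * derive1 f t).
Proof. by apply: is_derive_eq (is_deriveX 2 df) _; rewrite /GRing.scale /=; ring. Qed.
Let df4 : is_derive t 1 (fun s => 2^-1 * f s ^+ 4 : R^o) (2 * f t ^+ 3 * derive1 f t).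
Proof. by apply: is_derive_eq (is_deriveZ 2^-1 (is_deriveX 4 df)) _; rewrite /GRing.scale /=;
  field. Qed.

Local Opaque ffun_scale ffun_add ffun_opp ffun_zero wedge from_base.

Lemma ext_d_warped_g2 :
  ext_d phi z =
  B (f t ^+ 3 *: (alpha t *: ext_d (psip i) x - beta t *: ext_d (psim i) x)) +
  B (f t ^+ 2 *: ext_d (om i) x
     - (3 * f t ^+ 2 * derive1 f t * alpha t + f t ^+ 3 * derive1 alpha t) *: psip i x
     + (3 * f t ^+ 2 * derive1 f t * beta t + f t ^+ 3 * derive1 beta t) *: psim i x) \wedge dt.
Proof.
case: su3L => omF pF mF _.
have phiE : phi = fun y => f (time y) ^+ 2 *: (B (om i (base y)) \wedge dt) +
    (f (time y) ^+ 3 * alpha (time y)) *: B (psip i (base y)) +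
    (- (f (time y) ^+ 3 * beta (time y))) *: B (psim i (base y)).
  by apply/funext => y; rewrite /warped_g2 scalerBr !scalerA addrA scaleNr.
have := has_ext_dD (has_ext_dD (has_ext_d_cylinder_dt df2 (dom omF))
   (has_ext_d_cylinder dfa (dom pF))) (has_ext_d_cylinder dfnb (dom mF)).
rewrite -phiE => /has_ext_dE ->.
case: pF mF => _ /(_ i x zi) p3 _ [_ /(_ i x zi) m3 _].
rewrite (from_base_dtC p3) (from_base_dtC m3) !from_baseZ !from_baseD !from_baseN !from_baseZ.
by rewrite !wedgeDl !wedgeNl !wedgeZl; ext_combination.
Qed.

Lemma ext_d_star_warped_g2 :
  ext_d (fun y => g2_star (phi y) (phi y)) z =
  B (f t ^+ 4 *: (om i x \wedge ext_d (om i) x)) +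
  B ((2 * f t ^+ 3 * derive1 f t) *: (om i x \wedge om i x) +
     f t ^+ 3 *: (alpha t *: ext_d (psim i) x + beta t *: ext_d (psip i) x)) \wedge dt.
Proof.
case: su3L => omF pF mF _.
have [_ _ _ /(_ i) [_ codo _ _ _] _] := manL.
(* The closed form of [star phi] is available only over the chart and over I; both are open, and the
   derivative at z depends on the germ alone. *)
rewrite (@ext_d_near _ _ _ (fun y => (2^-1 * f (time y) ^+ 4) *: B (om i (base y) \wedge om i
  (base y)) +
    (f (time y) ^+ 3 * alpha (time y)) *: (B (psim i (base y)) \wedge dt) +
    (f (time y) ^+ 3 * beta (time y)) *: (B (psip i (base y)) \wedge dt))); last first.
  apply: filterS (near_base_time codo openI zi zI) => y [yi yI].
  rewrite warped_g2E (star_warped_form (su3_structure_adapted yi) (f_neq0 yI) (alpha_beta yI)).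
  rewrite !from_baseZ from_baseD !from_baseZ wedgeZl wedgeDl !wedgeZl scalerDr !scalerA addrA.
  by rewrite [_ / 2]mulrC.
have om2 : homog 2 (om i x) by case: omF => _ /(_ i x zi).
have := has_ext_dD (has_ext_dD (has_ext_d_cylinder df4 (has_ext_d_sqr2 om2 (dom omF)))
   (has_ext_d_cylinder_dt dfa (dom mF))) (has_ext_d_cylinder_dt dfb (dom pF)).
move=> /has_ext_dE ->.
rewrite (from_base_dtC (homog_wedge om2 om2)) !from_baseZ !from_baseD !from_baseZ !wedgeDl
  !wedgeZl.
rewrite from_baseD !from_baseZ wedgeDl !wedgeZl.
by ext_combination.
Qed.

End Warped.
End Main.

Local Open Scope classical_set_scope.
Local Open Scope ring_scope.

Theorem theorem3p4 (R : realType) (T : topologicalType) (L : atlas R 5 T)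
    (om psip psim : ext_field L)
    (pi0 sigma0 : scalar_field L) (pi1 nu1 pi2 sigma2 nu3 : ext_field L)
    (I : set R) (f alpha beta : R -> R)
    (manL : smooth_manifold L)
    (su3L : su3_structure om psip psim)
    (torL : su3_torsion om psip psim pi0 sigma0 pi1 nu1 pi2 sigma2 nu3)
    (openI : open I) (itvI : is_interval I)
    (smooth_f : smooth_on_interval I f)
    (smooth_alpha : smooth_on_interval I alpha)
    (smooth_beta : smooth_on_interval I beta)
    (f_neq0 : forall t, I t -> f t != 0)
    (f_nonconstant : exists s t, [/\ I s, I t & f s != f t])
    (alpha_beta : forall t, I t -> alpha t ^+ 2 + beta t ^+ 2 = 1)
    (tau0 : scalar_field (cylinder I L))
    (tau1 tau2 tau3 : ext_field (cylinder I L)) :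
  g2_torsion (warped_g2 f alpha beta om psip psim) tau0 tau1 tau2 tau3 <->
  (forall (i : chart (cylinder I L)) z, cod i z ->
    let x := base z in let t := time z in
    let o := om i x in let p := psip i x in let m := psim i x in
    let p0 := pi0 i x in let s0 := sigma0 i x in
    let p1 := pi1 i x in let n1 := nu1 i x in
    let p2 := pi2 i x in let s2 := sigma2 i x in let n3 := nu3 i x in
    let f_ := f t in let a := alpha t in let b := beta t in
    let f' : R := derive1 f t in let a' : R := derive1 alpha t in let b' : R := derive1 beta t in
    let star6 := su3_star o p m in
    let B := @from_base R 5 in
    [/\ tau0 i z =
          4 / (7 * f_) *
          (3 * p0 * a - 3 * s0 * b + f_ * a * b' - f_ * b * a'),
        tau1 i z =
          (1 / (2 * f_) * (p0 * b + s0 * a + 2 * f')) *: dt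
          + (1 / 6) *: B n1 + (1 / 6) *: B p1,
        tau2 i z =
          - (2 / 3) *: (B (star6 (n1 \wedge (o \wedge o))) \wedge dt)
          + (1 / 3) *: (B (star6 (p1 \wedge (o \wedge o))) \wedge dt)
          - (1 / 3 * f_ * b) *: B (star6 (p1 \wedge p))
          - (1 / 3 * f_ * a) *: B (star6 (p1 \wedge m))
          + (2 / 3 * f_ * b) *: B (star6 (n1 \wedge p))
          + (2 / 3 * f_ * a) *: B (star6 (n1 \wedge m))
          - (f_ * b) *: B p2 - (f_ * a) *: B s2 &
        tau3 i z =
          - (3 / 14 * f_ ^+ 2
               * (p0 * a ^+ 2 - s0 * a * b - 2 * f_ * b')) *: B p
          + (3 / 14 * f_ ^+ 2
               * (p0 * a * b - s0 * b ^+ 2 + 2 * f_ * a')) *: B m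
          + (2 / 7 * f_
               * (p0 * a - s0 * b - 2 * f_ * a * b' + 2 * f_ * b * a'))
            *: (B o \wedge dt)
          - (1 / 2 * f_ ^+ 2) *: B (star6 (n1 \wedge o))
          + (1 / 2 * f_ ^+ 2) *: B (star6 (p1 \wedge o))
          + (1 / 2 * f_ * a) *: (B (star6 (p1 \wedge p)) \wedge dt)
          - (1 / 2 * f_ * b) *: (B (star6 (p1 \wedge m)) \wedge dt)
          - (1 / 2 * f_ * a) *: (B (star6 (n1 \wedge p)) \wedge dt)
          + (1 / 2 * f_ * b) *: (B (star6 (n1 \wedge m)) \wedge dt)
          + f_ *: (B (a *: p2 - b *: s2) \wedge dt)
          - f_ ^+ 2 *: B (star6 n3)]).
Proof.
have [_ [hp1 hn1] [hp2 hs2] hn3 tors] := torL.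
(* At one point, the torsion system is equivalent to the formulas written with k. Both directions of
   the theorem follow by restoring the derivatives of alpha and beta. *)
have key (i : chart L) z : cod (i : chart (cylinder I L)) z ->
  exists k, [/\ derive1 alpha (time z) = - (beta (time z) * k),
    derive1 beta (time z) = alpha (time z) * k &
    forall t0 t1 t2 t3,
    (let phi := @warped_g2 _ _ I L f alpha beta om psip psim i in
    let star := g2_star (phi z) in
    [/\ [/\ homog 1 t1, homog 2 t2 & homog 3 t3],
        g2_type214 (phi z) t2,
        g2_type327 (phi z) t3,
        ext_d phi z = t0 *: star (phi z) + 3 *: (t1 \wedge phi z) + star t3 &
        ext_d (fun y => g2_star (phi y) (phi y)) z =
          4 *: (t1 \wedge star (phi z)) + t2 \wedge phi z]) <->
    [/\ t0 = warped_tau0 (f (time z)) (alpha (time z)) (beta (time z)) (pi0 i (base z))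
      (sigma0 i (base z)) k,
        t1 = warped_tau1 (f (time z)) (alpha (time z)) (beta (time z)) (pi0 i (base z))
          (sigma0 i (base z))
               (derive1 f (time z)) (pi1 i (base z)) (nu1 i (base z)),
        t2 = warped_tau2 (om i (base z)) (psip i (base z)) (psim i (base z)) (f (time z))
          (alpha (time z))
               (beta (time z)) (pi1 i (base z)) (nu1 i (base z)) (pi2 i (base z)) (sigma2 i
                 (base z)) &
        t3 = warped_tau3 (om i (base z)) (psip i (base z)) (psim i (base z)) (f (time z))
          (alpha (time z))
               (beta (time z)) (pi0 i (base z)) (sigma0 i (base z)) k (pi1 i (base z)) (nu1 i
                 (base z))
               (pi2 i (base z)) (sigma2 i (base z)) (nu3 i (base z))]].
  move=> /cod_cylinder [zi zI].
  have adapted := su3_structure_adapted su3L zi.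
  have f0 := f_neq0 _ zI; have ab := alpha_beta _ zI.
  have dab := circle_derivative openI zI alpha_beta smooth_alpha smooth_beta.
  have [[p28 s28] n312 dO dP dM] := tors i (base z) zi.
  have h1 : homog 1 (pi1 i (base z)) by case: hp1 => _ + _; apply.
  have h2 : homog 1 (nu1 i (base z)) by case: hn1 => _ + _; apply.
  have h3 : homog 2 (pi2 i (base z)) by case: hp2 => _ + _; apply.
  have h4 : homog 2 (sigma2 i (base z)) by case: hs2 => _ + _; apply.
  have h5 : homog 3 (nu3 i (base z)) by case: hn3 => _ + _; apply.
  have eqd := ext_d_warped_g2 su3L smooth_f smooth_alpha smooth_beta zi zI.
  have eqs := ext_d_star_warped_g2 manL su3L openI smooth_f smooth_alpha smooth_beta f_neq0
    alpha_beta zi zI.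
  move: eqd eqs dab; rewrite dO dP dM.
  set a := alpha (time z) in ab *; set b := beta (time z) in ab *.
  move: (derive1 alpha (time z)) (derive1 beta (time z)) => a' b' eqd eqs dab.
  (* The vector (a', b') is orthogonal to the unit vector (a, b), hence is a multiple of (-b, a),
     with factor a b' - b a'. *)
  have a'E : a' = - (b * (a * b' - b * a')).
    apply/eqP; rewrite -subr_eq0; have -> : a' - - (b * (a * b' - b * a')) =
      a' * (1 - (a ^+ 2 + b ^+ 2)) + a * (a * a' + b * b') by ring.
    by rewrite ab dab subrr !mulr0 addr0.
  have b'E : b' = a * (a * b' - b * a').
    apply/eqP; rewrite -subr_eq0; have -> : b' - a * (a * b' - b * a') =
      b' * (1 - (a ^+ 2 + b ^+ 2)) + b * (a * a' + b * b') by ring.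
    by rewrite ab dab subrr !mulr0 addr0.
  move: (a * b' - b * a') a'E b'E eqd eqs {dab} => k -> -> eqd eqs.
  exists k; split; [by []|by []|move=> t0 t1 t2 t3].
  have [w1 w2 w3] := homog_warped_tau (f (time z)) a b adapted (pi0 i (base z)) (sigma0 i
    (base z))
    (derive1 f (time z)) k h1 h2 h3 h4 h5.
  have T2 := warped_tau2_type adapted f0 ab h1 h2 h3 h4 h5 p28 s28 n312.
  have T3 := warped_tau3_type adapted f0 ab (pi0 i (base z)) (sigma0 i (base z)) k h1 h2 h3 h4
    h5 p28 s28 n312.
  rewrite (warped_d_phi adapted f0 ab _ _ _ _ h1 h2 h3 h4 h5 p28 s28) in eqd.
  rewrite (warped_d_star_phi adapted f0 ab _ _ _ h1 h2 h3 h4 h5 p28 s28 n312) in eqs.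
  split=> [[[u1 u2 u3] U2 U3 eqd' eqs']|[-> -> -> ->]]; last by split.
  exact: (g2_torsion_unique (warped_coframe adapted f0 ab) u1 u2 u3 U2 U3 eqd' eqs' w1 w2 w3
    T2 T3 eqd eqs).
split=> [tor i z zi | formulas i z zi].
  have [k [a'E b'E kk]] := key i z zi.
  have [/(_ (tor i z zi)) [-> -> -> ->] _] := kk (tau0 i z) (tau1 i z) (tau2 i z) (tau3 i z).
  by split; rewrite ?warped_tau1E ?warped_tau2E ?warped_tau3E /warped_tau0 /warped_tau1_dt
    -?a'E -?b'E.
have [k [a'E b'E kk]] := key i z zi; apply/kk.
have [-> -> -> ->] := formulas i z zi.
by split; rewrite ?warped_tau1E ?warped_tau2E ?warped_tau3E /warped_tau0 /warped_tau1_dt -?a'E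
  -?b'E.
Qed.
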